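(* Let $N\ge 2$ be an integer, let $2\le p\le N$, and let $a_1,\dots,a_p$ be distinct integers in $\{0,\dots,N-1\}$. Let $\mathbf{C}=\{\sum_{j\ge 1}d_jN^{-j} : d_j\in\{a_1,\dots,a_p\}\text{ for all } j\ge 1\}$ be the attractor of the maps $\sigma_i(x)=\frac1N(x+a_i)$, $1\le i\le p$, let $s=\log_N p$, let $\mathcal{R}=\bigcup_{n\in\mathbb{Z}}\bigcup_{k\in\mathbb{Z}}N^{-n}(\mathbf{C}+k)$, and let $\mathcal{H}^s$ be $s$-dimensional Hausdorff measure on $\mathcal{R}$, normalized so that $\mathcal{H}^s(\mathbf{C})=1$. On $L^2(\mathcal{R},\mathcal{H}^s)$ let $Tf(x)=f(x-1)$, $Uf(x)=\frac1{\sqrt p}f(x/N)$, and let $\varphi=\chi_{\mathbf{C}}$. Label the functions $z\mapsto z^d$, $d\in\{0,\dots,N-1\}\setminus\{a_1,\dots,a_p\}$, as $m_1,\dots,m_{N-p}$, and with $\eta=e^{2\pi i/p}$ set $$m_{N-p+k}(z)=\frac{1}{\sqrt p}\sum_{i=1}^p\eta^{k(i-1)}z^{a_i},\qquad k\in\{1,\dots,p-1\}.$$ Define $\psi_i=U^{-1}m_i(T)\varphi$ for $i\in\{1,\dots,N-1\}$. Then $$\{U^mT^n\psi_i : m,n\in\mathbb{Z},\ i\in\{1,\dots,N-1\}\}$$ is an orthonormal basis of $L^2(\mathcal{R},\mathcal{H}^s)$.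
   Context: For a Laurent polynomial $m(z)=\sum_k c_kz^k$, $m(T)$ denotes $\sum_k c_kT^k$. The operators $T$ and $U$ are unitary and satisfy $UTU^{-1}=T^N$. *)

(* Defs.v *)
From HB Require Import structures.
From mathcomp Require Import all_boot all_order all_algebra.
From mathcomp Require Import complex lra.
From mathcomp Require Import all_classical all_reals all_analysis.

Set Implicit Arguments.
Unset Strict Implicit.
Unset Printing Implicit Defensive.
Import Order.TTheory GRing.Theory Num.Theory.
Import numFieldNormedType.Exports.

Local Open Scope classical_set_scope.
Local Open Scope ring_scope.
Local Open Scope complex_scope.

Section hausdorff_measure.
Context {R : realType}.
Local Open Scope ereal_scope.
Implicit Types (A B : set R) (F : (set R)^nat) (s : R).

(* The supremum over the empty set is -oo, so this is meant for A !=set0. *)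
Definition ediam A : \bar R :=
  ereal_sup [set `|z.1 - z.2|%:E | z in A `*` A].

(* diam(A)^s, with the value 0 on the empty set. *)
Definition hausdorff_gauge s A : \bar R :=
  if A == set0 then 0 else ediam A `^ s.

Definition delta_cover (delta : R) A : set ((set R)^nat) :=
  [set F | A `<=` \bigcup_j F j /\ forall j, ediam (F j) <= delta%:E].

Definition hausdorff_content s (delta : R) A : \bar R :=
  ereal_inf [set \sum_(j <oo) hausdorff_gauge s (F j) | F in delta_cover delta A].

Definition hausdorff_measure s A : \bar R :=
  ereal_sup [set hausdorff_content s delta A | delta in [set d : R | (0 < d)%R]].

Lemma hausdorff_gauge_ge0 s A : 0 <= hausdorff_gauge s A.
Proof. by rewrite /hausdorff_gauge; case: ifP => // _; exact: poweR_ge0. Qed.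

Lemma hausdorff_gauge0 s : hausdorff_gauge s set0 = 0.
Proof. by rewrite /hausdorff_gauge eqxx. Qed.

Lemma ediam0 : ediam set0 = -oo.
Proof. by rewrite /ediam setX0 image_set0 ereal_sup0. Qed.

Lemma ge_ediam A x y : A x -> A y -> `|x - y|%:E <= ediam A.
Proof. by move=> Ax Ay; apply: ereal_sup_ubound; exists (x, y). Qed.

Lemma hausdorff_content_ge0 s d A : 0 <= hausdorff_content s d A.
Proof.
apply: le_ereal_inf_tmp => _ [F _ <-].
by apply: nneseries_ge0 => n _ _; exact: hausdorff_gauge_ge0.
Qed.

Lemma le_hausdorff_content s d A B : A `<=` B ->
  hausdorff_content s d A <= hausdorff_content s d B.
Proof.
move=> AB; apply: ereal_inf_le_tmp => _ [F [BF dF] <-].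
by exists F => //; split=> //; exact: subset_trans BF.
Qed.

Lemma hausdorff_content_anti s d d' A : (d <= d')%R ->
  hausdorff_content s d' A <= hausdorff_content s d A.
Proof.
move=> dd; apply: ereal_inf_le_tmp => _ [F [BF dF] <-].
by exists F => //; split=> // j; rewrite (le_trans (dF j))// lee_fin.
Qed.

Lemma hausdorff_content0 s d : hausdorff_content s d set0 = 0.
Proof.
apply/eqP; rewrite eq_le hausdorff_content_ge0 andbT.
apply: ereal_inf_lbound; exists (fun=> set0).
  by split=> // j; rewrite ediam0 leNye.
by rewrite eseries0// => i _ _; rewrite hausdorff_gauge0.
Qed.

Lemma hausdorff_content_sigma_subadditive s d :
  sigma_subadditive (hausdorff_content s d).
Proof.
move=> A.
have [[i ioo]|] := pselect (exists i, hausdorff_content s d (A i) = +oo).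
  rewrite (eseries_pinfty _ _ ioo) ?leey// => n _.
  by rewrite -ltNye (lt_le_trans _ (hausdorff_content_ge0 _ _ _)).
rewrite -forallNE => Aoo.
apply/lee_addgt0Pr => e e0.
rewrite (le_trans _ (epsilon_trick _ _ (ltW e0)))//; last first.
  by move=> n; exact: hausdorff_content_ge0.
pose P n (B : (set R)^nat) := delta_cover d (A n) B /\
  \sum_(k <oo) hausdorff_gauge s (B k) <=
    hausdorff_content s d (A n) + (e / (2 ^ n.+1)%:R)%:E.
have [G PG] : {G : ((set R)^nat)^nat & forall n, P n (G n)}.
  apply: (@choice _ _ P) => n; rewrite /P.
  have fA : hausdorff_content s d (A n) \is a fin_num.
    by rewrite ge0_fin_numE ?hausdorff_content_ge0// ltey; exact/eqP/Aoo.
  have en : (0 < e / (2 ^ n.+1)%:R)%R by rewrite divr_gt0// ltr0n expn_gt0.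
  have [_ [B cB <-] xB] := lb_ereal_inf_adherent en fA.
  by exists B; split=> //; exact: ltW.
pose g := hausdorff_gauge s \o uncurry G.
have g_ge0 x : 0 <= g x by exact: hausdorff_gauge_ge0.
apply: (@le_trans _ _ (\esum_(i in setT) g i)).
  apply: ereal_inf_lbound => /=.
  have /card_esym/ppcard_eqP[f] := card_nat2.
  exists (uncurry G \o f).
    split.
      move=> t [i _ Ait]; have [+ _] := (PG i).1 => /(_ t Ait)[j _ Gt].
      by exists (f^-1%FUN (i, j)) => //=; rewrite invK ?inE.
    by move=> j /=; case: (f j) => a b /=; exact: (PG a).1.2.
  rewrite -(esum_pred_image g _ xpredT) ?[fun=> _]set_true//.
  by rewrite image_eq.
rewrite (_ : esum _ _ = \sum_(i <oo) \sum_(j <oo) g (i, j)); last first.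
  pose J : nat -> set (nat * nat) := fun i => [set (i, j) | j in setT].
  rewrite (_ : setT = \bigcup_k J k); last first.
    by rewrite predeqE => -[a b]; split => // _; exists a => //; exists b.
  rewrite esum_bigcupT //=; last first.
    apply/trivIsetP => i j _ _ ij.
    rewrite predeqE => -[n m] /=; split => //= -[] [_] _ [<-{n} _].
    by move=> [m' _] [] /esym/eqP; rewrite (negbTE ij).
  rewrite -(image_id [set: nat]) -fun_true esum_pred_image//; last first.
    by move=> n _; exact: esum_ge0.
  apply: eq_eseriesr => /= j _.
  rewrite -(esum_pred_image g (pair j) predT)//=; last first.
    by move=> ? ? _ _; exact: (@can_inj _ _ _ snd).
  by congr esum; rewrite predeqE => -[a b]; split; move=> [i _ <-]; exists i.
apply: lee_nneseries => [n _ _|n _]; last exact: (PG n).2.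
exact: nneseries_ge0.
Qed.

Lemma hausdorff_content_le_measure s d A : (0 < d)%R ->
  hausdorff_content s d A <= hausdorff_measure s A.
Proof. by move=> d0; apply: ereal_sup_ubound; exists d. Qed.

Lemma hausdorff_measure_ge0 s A : 0 <= hausdorff_measure s A.
Proof.
exact: le_trans (hausdorff_content_ge0 s 1 A) (hausdorff_content_le_measure _ _ _).
Qed.

Lemma hausdorff_measure0 s : hausdorff_measure s set0 = 0.
Proof.
apply/eqP; rewrite eq_le hausdorff_measure_ge0 andbT.
by apply: ge_ereal_sup => _ [d _ <-]; rewrite hausdorff_content0.
Qed.

Lemma le_hausdorff_measure s :
  {homo hausdorff_measure s : A B / A `<=` B >-> A <= B}.
Proof.
move=> A B AB; apply: ge_ereal_sup => _ [d d0 <-].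
exact: le_trans (le_hausdorff_content _ _ AB) (hausdorff_content_le_measure _ _ _).
Qed.

Lemma hausdorff_measure_sigma_subadditive s :
  sigma_subadditive (hausdorff_measure s).
Proof.
move=> F; apply: ge_ereal_sup => _ [d d0 <-].
apply: le_trans (hausdorff_content_sigma_subadditive _ _ _) _.
apply: lee_nneseries => [n _ _|n _]; first exact: hausdorff_content_ge0.
exact: hausdorff_content_le_measure.
Qed.

HB.instance Definition _ s := isOuterMeasure.Build R R (hausdorff_measure s)
  (hausdorff_measure0 s) (hausdorff_measure_ge0 s) (@le_hausdorff_measure s)
  (@hausdorff_measure_sigma_subadditive s).

Lemma hausdorff_content_separated s d A B (e : R) :
  (d < e)%R -> (forall x y, A x -> B y -> (e <= `|x - y|)%R) ->
  hausdorff_content s d A + hausdorff_content s d B <=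
  hausdorff_content s d (A `|` B).
Proof.
move=> de AB; apply: le_ereal_inf_tmp => _ [F [cF dF] <-].
pose meets C j := if `[< F j `&` C !=set0 >] then F j else set0.
have cmeets C : C `<=` A `|` B -> delta_cover d C (meets C).
  move=> CAB; split=> [x Cx|j].
    have [j _ Fx] := cF x (CAB x Cx); exists j => //.
    by rewrite /meets asboolT//; exists x.
  by rewrite /meets; case: ifP => // _; rewrite ediam0 leNye.
have le_meets C : C `<=` A `|` B -> hausdorff_content s d C <=
    \sum_(j <oo) hausdorff_gauge s (meets C j).
  by move=> CAB; apply: ereal_inf_lbound; exists (meets C) => //; exact: cmeets.
apply: le_trans (leeD (le_meets A _) (le_meets B _)) _.
- exact: subsetUl.
- exact: subsetUr.
rewrite -nneseriesD; [|by move=> *; exact: hausdorff_gauge_ge0..].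
apply: lee_nneseries => [j _ _|j _].
  by apply: adde_ge0; exact: hausdorff_gauge_ge0.
rewrite /meets; case: asboolP => [[x [Fx Ax]]|_]; case: asboolP => [[y [Fy By]]|_];
  rewrite ?hausdorff_gauge0 ?adde0 ?add0e ?hausdorff_gauge_ge0//.
have := le_trans (ge_ediam Fx Fy) (dF j).
by rewrite lee_fin => /(le_trans (AB _ _ Ax By)); rewrite leNgt de.
Qed.

Lemma hausdorff_measure_separated s A B (e : R) :
  (0 < e)%R -> (forall x y, A x -> B y -> (e <= `|x - y|)%R) ->
  hausdorff_measure s A + hausdorff_measure s B <= hausdorff_measure s (A `|` B).
Proof.
move=> e0 AB.
have key d d' : (0 < d)%R -> (0 < d')%R ->
    hausdorff_content s d A + hausdorff_content s d' B <=
    hausdorff_measure s (A `|` B).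
  move=> d0 d'0; pose m := Num.min (Num.min d d') (e / 2)%R.
  have m0 : (0 < m)%R by rewrite !lt_min d0 d'0/= divr_gt0.
  have me : (m < e)%R.
    by rewrite gt_min ltr_pdivrMr// mulr_natr mulr2n ltrDl e0 orbT.
  apply: le_trans (hausdorff_content_le_measure _ _ m0).
  apply: le_trans (hausdorff_content_separated s me AB).
  by apply: leeD; apply: hausdorff_content_anti; rewrite !ge_min lexx ?orbT.
have [->|Hoo] := eqVneq (hausdorff_measure s (A `|` B)) +oo; first exact: leey.
have HU : hausdorff_measure s (A `|` B) \is a fin_num.
  by rewrite ge0_fin_numE ?hausdorff_measure_ge0// ltey.
have fin C : C `<=` A `|` B -> hausdorff_measure s C \is a fin_num.
  move=> CU; rewrite ge0_fin_numE ?hausdorff_measure_ge0//.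
  by apply: le_lt_trans (le_hausdorff_measure s CU) _; rewrite ltey.
have fB : hausdorff_measure s B \is a fin_num by apply: fin; exact: subsetUr.
rewrite -leeBrDr//; apply: ge_ereal_sup => _ [d d0 <-].
have fAd : hausdorff_content s d A \is a fin_num.
  rewrite ge0_fin_numE ?hausdorff_content_ge0//.
  apply: le_lt_trans (hausdorff_content_le_measure s A d0) _.
  by rewrite ltey_eq fin//; exact: subsetUl.
rewrite leeBrDr// -leeBrDl//; apply: ge_ereal_sup => _ [d' d'0 <-].
by rewrite leeBrDl//; exact: key.
Qed.

Lemma hausdorff_measure_caratheodory_itv s (a : R) :
  (hausdorff_measure s).-caratheodory `]-oo, a].
Proof.
apply: le_caratheodory_measurable => X.
pose H := hausdorff_measure s.
change (H (X `&` `]-oo, a]) + H (X `&` ~` `]-oo, a]) <= H X).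
have [->|Xoo] := eqVneq (H X) +oo; first exact: leey.
pose Y k := X `&` [set x | a + k.+1%:R^-1 < x]%R.
pose D k := Y k.+1 `\` Y k.
have H0 Z : 0 <= H Z by exact: hausdorff_measure_ge0.
have HX Z : Z `<=` X -> H Z <= H X by move=> /le_hausdorff_measure; exact.
have YX k : Y k `<=` X by move=> x [].
have incY m n : (m <= n)%N -> Y m `<=` Y n.
  move=> mn x [Xx] /= mx; split=> //=; apply: le_lt_trans mx.
  by rewrite lerD2l lef_pV2 ?posrE ?ltr0n// ler_nat ltnS.
have sumD n : \sum_(k < n) H (D k) <= H (Y n) + H (Y n.-1).
  elim: n => [|[|n] IH]; first by rewrite big_ord0 adde_ge0.
    rewrite big_ord_recr/= big_ord0 add0e (@le_trans _ _ (H (Y 1%N)))//.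
      by apply: le_hausdorff_measure => x [].
    by rewrite leeDl.
  rewrite big_ord_recr/= [leRHS]addeC.
  apply: le_trans (leeD IH (lexx _)) _; rewrite -addeA leeD2l//=.
  pose e : R := (n.+1%:R^-1 - n.+2%:R^-1)%R.
  have e0 : (0 < e)%R by rewrite subr_gt0 ltf_pV2 ?posrE ?ltr0n// ltr_nat.
  apply: le_trans (hausdorff_measure_separated s e0 _) _.
    move=> x y [_ /= xa] [[Xy _] /not_andP[//|/negP]]; rewrite -leNgt => ya.
    apply: le_trans (ler_norm _); move: xa ya; rewrite /e {e0 e}.
    by move: (n.+1%:R^-1)%R (n.+2%:R^-1)%R => u v; lra.
  apply: le_hausdorff_measure => x [|[]//].
  by apply: incY; rewrite -addn2 leq_addr.
have sumDX : \sum_(k <oo) H (D k) < +oo.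
  apply: (@le_lt_trans _ _ (H X + H X)); last first.
    by rewrite lte_add_pinfty// ltey.
  apply: lime_le; first exact: is_cvg_nneseries.
  apply: nearW => n; rewrite big_mkord (le_trans (sumD n))// leeD//; exact/HX/YX.
have tail := nneseries_tail_cvg sumDX (fun k _ => H0 (D k)).
have le_tail n : H (X `&` ~` `]-oo, a]) <= H (Y n) + \sum_(n <= k <oo) H (D k).
  have cov : X `&` ~` `]-oo, a] `<=` Y n `|` \bigcup_(k in ~` `I_n) D k.
    move=> x [Xx] /=; rewrite in_itv/= => /negP; rewrite -ltNge => ax.
    have [k kx] : exists k, Y k x by have [k ?] := ltr_add_invr ax; exists k.
    have [|nYx] := pselect (Y n x); [by left|right].
    elim: k kx => [|k IH] kx; first by case: nYx; exact: incY kx.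
    have [Ykx|nYkx] := pselect (Y k x); first exact: IH.
    exists k => //=; apply/negP; rewrite -leqNgt leqNgt; apply/negP => kn.
    by case: nYx; exact: incY kx.
  apply: le_trans (le_hausdorff_measure s cov) _.
  apply: le_trans (outer_measureU2 _ _ _) _; rewrite leeD2l//.
  exact: outer_measure_sigma_subadditive_tail.
have lower n : H (X `&` `]-oo, a]) + H (Y n) <= H X.
  have n0 : (0 < n.+1%:R^-1 :> R)%R by rewrite invr_gt0 ltr0n.
  apply: le_trans (hausdorff_measure_separated s n0 _) _.
    move=> x y [_ /=]; rewrite in_itv/= => xa [_ /= ya].
    rewrite distrC; apply: le_trans (ler_norm _); move: xa ya {n0}.
    by move: (n.+1%:R^-1)%R => u; lra.
  by apply: HX => x [[]|[]].
apply/lee_addgt0Pr => e e0.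
have [n ne] : exists n, \sum_(n <= k <oo) H (D k) < e%:E.
  suff : \forall n \near \oo, \sum_(n <= k <oo) H (D k) < e%:E.
    by move=> /filter_ex.
  apply: (tail [set x | x < e%:E]); apply: open_nbhs_nbhs.
  by split; [exact: open_ereal_lt_ereal|rewrite /= lte_fin].
apply: (@le_trans _ _ (H (X `&` `]-oo, a]) + (H (Y n) + e%:E))).
  by rewrite leeD2l// (le_trans (le_tail n))// leeD2l// ltW.
by rewrite addeA leeD2r.
Qed.

Lemma hausdorff_measure_caratheodory s (A : set (measurableTypeR R)) :
  measurable A -> (hausdorff_measure s).-caratheodory A.
Proof.
move: A; apply: smallest_sub.
  split=> [|A|F]; first exact: caratheodory_measurable_set0.
    by rewrite setTD; exact: caratheodory_measurable_setC.
  exact: caratheodory_measurable_bigcup.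
move=> _ [[x y] /= _ <-].
rewrite (_ : `]x, y]%classic = `]-oo, y] `\` `]-oo, x]).
  by apply: caratheodory_measurable_setD;
    exact: hausdorff_measure_caratheodory_itv.
apply/seteqP; split=> z /=; rewrite !in_itv/=.
  by move=> /andP[xz zy]; split=> //; apply/negP; rewrite -ltNge.
by move=> [-> /negP]; rewrite -ltNge => ->.
Qed.

Definition borel_hausdorff_measure s : set (measurableTypeR R) -> \bar R :=
  hausdorff_measure s.

Lemma borel_hausdorff_measure_sigma_additive s :
  semi_sigma_additive (borel_hausdorff_measure s).
Proof.
move=> F mF tF _; apply: caratheodory_measure_sigma_additive => //.
  by move=> i; exact: hausdorff_measure_caratheodory.
apply: caratheodory_measurable_bigcup => i.
exact: hausdorff_measure_caratheodory.
Qed.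

HB.instance Definition _ s := isMeasure.Build _ (measurableTypeR R) R
  (borel_hausdorff_measure s) (hausdorff_measure0 s) (hausdorff_measure_ge0 s)
  (@borel_hausdorff_measure_sigma_additive s).

End hausdorff_measure.

Local Notation normc := ComplexField.Normc.normc.

Section L2_space.
Context d (T : measurableType d) (R : realType).
Variables (mu : {measure set T -> \bar R}) (D : set T).
Implicit Types f g : T -> R[i].

(* Elements of L^2(D, mu) are represented by functions on T, whose values
   outside D are irrelevant; equality of classes is equality mu-a.e. on D.
   D is meant to be measurable (otherwise measurable_fun D _ is vacuous). *)
Definition L2 : set (T -> R[i]) := [set f : T -> R[i] |
  [/\ measurable_fun D (fun x => complex.Re (f x)),
      measurable_fun D (fun x => complex.Im (f x)) &
      (\int[mu]_(x in D) (normc (f x) ^+ 2)%:E < +oo)%E]].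

Definition L2dot f g : R[i] :=
  (\int[mu]_(x in D) complex.Re (f x * (g x)^*)) +i*
  (\int[mu]_(x in D) complex.Im (f x * (g x)^*)).

Definition L2norm f : \bar R :=
  ((\int[mu]_(x in D) (normc (f x) ^+ 2)%:E) `^ 2^-1)%E.

Definition orthonormal (I : eqType) (e : I -> T -> R[i]) :=
  forall i j, L2dot (e i) (e j) = (i == j)%:R.

Definition dense_span (I : Type) (e : I -> T -> R[i]) :=
  forall f, L2 f -> forall eps : R, 0 < eps ->
  exists (s : seq I) (c : I -> R[i]),
    (L2norm (fun x => f x - \sum_(i <- s) c i * e i x)%R < eps%:E)%E.

Definition orthonormal_basis (I : eqType) (e : I -> T -> R[i]) :=
  [/\ forall i, L2 (e i), orthonormal e & dense_span e].

End L2_space.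

Section fractal.
Context {R : realType} (N : nat) (a : seq nat).

Definition fractal : set R := [set x |
  exists2 d : nat -> nat, (forall j, (1 <= j)%N -> d j \in a) &
    \sum_(1 <= j < n) (d j)%:R / N%:R ^+ j @[n --> \oo] --> x].

Definition inflated_fractal : set R :=
  \bigcup_(n in [set: int]) \bigcup_(k in [set: int])
    [set N%:R ^ (- n) * (x + k%:~R) | x in fractal].

Definition fractal_dim : R := ln (size a)%:R / ln N%:R.

(* The fractal satisfies the open set condition, so that H^s(C) is positive and
   finite in dimension s = fractal_dim and the factor below is 1 / H^s(C). *)
Lemma normalization_ge0 :
  0 <= (fine (hausdorff_measure fractal_dim fractal))^-1.
Proof. by rewrite invr_ge0 fine_ge0// hausdorff_measure_ge0. Qed.

Definition fractal_measure : {measure set (measurableTypeR R) -> \bar R} :=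
  mscale (NngNum normalization_ge0)
    (borel_hausdorff_measure fractal_dim).

End fractal.

Section operators.
Context {R : realType}.
Implicit Types (f : R -> R[i]) (F G : (R -> R[i]) -> R -> R[i]).

(* These act on L^2(inflated_fractal N a), as inflated_fractal N a is invariant
   under x |-> x - 1 and x |-> x / N. *)
Definition translation f : R -> R[i] := fun x => f (x - 1).
Definition translation_inv f : R -> R[i] := fun x => f (x + 1).

Definition dilation (N p : nat) f : R -> R[i] :=
  fun x => (Num.sqrt p%:R)^-1%:C * f (x / N%:R).
Definition dilation_inv (N p : nat) f : R -> R[i] :=
  fun x => (Num.sqrt p%:R)%:C * f (N%:R * x).

Lemma translationK : cancel translation translation_inv.
Proof. by move=> f; apply/funext => x; rewrite /translation_inv/translation addrK. Qed.

Lemma translation_invK : cancel translation_inv translation.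
Proof. by move=> f; apply/funext => x; rewrite /translation_inv/translation subrK. Qed.

Lemma dilationK N p : (0 < N)%N -> (0 < p)%N ->
  cancel (dilation N p) (dilation_inv N p).
Proof.
move=> N0 p0 f; apply/funext => x; rewrite /dilation_inv /dilation.
rewrite mulrA -rmorphM/= divff ?sqrtr_eq0 -?ltNge ?ltr0n// mul1r.
by rewrite mulrAC divff ?mul1r// pnatr_eq0 -lt0n.
Qed.

Lemma dilation_invK N p : (0 < N)%N -> (0 < p)%N ->
  cancel (dilation_inv N p) (dilation N p).
Proof.
move=> N0 p0 f; apply/funext => x; rewrite /dilation_inv /dilation.
rewrite mulrA -rmorphM/= mulVf ?sqrtr_eq0 -?ltNge ?ltr0n// mul1r.
by rewrite mulrCA divff ?mulr1// pnatr_eq0 -lt0n.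
Qed.

(* F^m for m : int, where G is the inverse of F. *)
Definition op_power F G (m : int) : (R -> R[i]) -> R -> R[i] :=
  match m with Posz n => iter n F | Negz n => iter n.+1 G end.

Definition Tpow := op_power translation translation_inv.
Definition Upow N p := op_power (dilation N p) (dilation_inv N p).

(* m(T) f; the Laurent polynomials needed below have no negative exponent. *)
Definition poly_T (m : {poly R[i]}) f : R -> R[i] :=
  fun x => \sum_(k < size m) m`_k * Tpow k f x.

End operators.

Section wavelets.
Context {R : realType} (N p : nat) (a b : seq nat).

Definition scaling_function : R -> R[i] := fun x => (\1_(fractal N a) x)%:C.

Definition eta : R[i] := cos (2 * pi / p%:R) +i* sin (2 * pi / p%:R).

(* a = [:: a_1; ...; a_p] lists the digits of the fractal, and
   b = [:: b_1; ...; b_(N-p)] the remaining ones, in the order that labels the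
   monomials z^d as m_1, ..., m_(N-p); wavelet_filter i is m_i for 1 <= i < N. *)
Definition wavelet_filter (i : nat) : {poly R[i]} :=
  if (i <= N - p)%N then 'X^(nth 0%N b i.-1)
  else let k := (i - (N - p))%N in
    ((Num.sqrt p%:R)^-1%:C) *:
      \sum_(1 <= j < p.+1) (eta ^+ (k * j.-1)) *: 'X^(nth 0%N a j.-1).

Definition wavelet (i : nat) : R -> R[i] :=
  Upow N p (-1) (poly_T (wavelet_filter i) scaling_function).

End wavelets.

(* Main.v *)
Require Import Defs.
From HB Require Import structures.
From mathcomp Require Import all_boot all_order all_algebra.
From mathcomp Require Import complex lra ring zify.
From mathcomp Require Import all_classical all_reals all_analysis.
From mathcomp Require Import measurable_realfun measurable_fun_approximation.

Set Implicit Arguments.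
Unset Strict Implicit.
Unset Printing Implicit Defensive.
Import Order.TTheory GRing.Theory Num.Theory.
Import numFieldNormedType.Exports.

Local Open Scope classical_set_scope.
Local Open Scope ring_scope.
Local Open Scope complex_scope.

(** For integers q and k, the set N^(-q) (C + k) agrees, up to countably many
    points, with a [cell]: the set of the x with floor (N^q x) = k all of
    whose later base-N digits belong to a. Cells of one generation q are
    pairwise disjoint, and each of them is the disjoint union of the p cells of
    generation q + 1 with index N k + e, for e in a ([cell_split]). Since
    Hausdorff measure is translation invariant, this splitting forces every
    cell of generation q to have measure p^(-q) ([fractal_measure_cell]), as
    soon as the measure of C is positive and finite. Positivity comes from a
    mass distribution ([hausdorff_fractal_gt0]): reading the base-p digits of
    y in [0, 1) as digits from a carries Lebesgue measure to C, and a set of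
    diameter at most N^(-k) receives mass at most 5 p^(-k). Countable sets are
    null because s > 0, so the closed sets may be replaced by cells throughout
    ([orthonormal_basis_ae]).

    Let e(q, k) be the normalized indicator p^(q/2) 1_cell(q, k). For a fixed q
    these functions are orthonormal. The wavelet U^m T^n psi_i is the
    combination of the e(1 - m, N n + d), 0 <= d < N, with coefficients m_i[d],
    and the splitting of cells says that e(q - 1, n) is the combination of the
    e(q, N n + d) with the coefficients of the low-pass filter
    m_0(z) = p^(-1/2) (z^a_1 + ... + z^a_p) ([cell_fun_refine]). The matrix of
    the N filters m_0, ..., m_(N-1) is unitary: it consists of the unitary
    Fourier matrix on the digits in a and of unit vectors on the other digits.

    Orthogonality of its rows ([filt_rows]) makes the wavelets of one generation
    orthonormal, and orthogonal to all the e(q - 1, n), hence to all coarser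
    wavelets. Orthogonality of its columns ([filt_cols]) writes e(q, k) as a
    combination of wavelets plus one multiple c e(q - 1, n), with
    |c|^2 <= 1/p; after M steps the remainder has squared norm at most p^(-M)
    ([cell_fun_remainder]), so that every e(q, k) lies in the closed span of
    the wavelets. Finally the cells span a dense subspace: the sets floor
    (N^n x) = m generate the Borel sets, which gives the indicators of all
    Borel subsets of a cell by a Dynkin class argument
    ([measurable_cell_approximable]), then all square-integrable functions on a
    cell by simple functions, then all of L^2 because countably many cells
    exhaust the inflated fractal up to a null set ([all_approximable]). *)

Local Notation normc := ComplexField.Normc.normc.

(** * Square-integrable complex functions and their inner product *)

Section L2_theory.
Context d (T : measurableType d) (R : realType).
Variables (mu : {measure set T -> \bar R}) (D : set T) (mD : measurable D).
Implicit Types (f g : T -> R[i]) (c : R[i]).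

Lemma normc_sq (z : R[i]) : normc z ^+ 2 = complex.Re z ^+ 2 + complex.Im z ^+ 2.
Proof. by case: z => x y /=; rewrite sqr_sqrtr// addr_ge0 ?sqr_ge0. Qed.

Lemma normc_sqD (z w : R[i]) :
  normc (z + w) ^+ 2 <= 2 * normc z ^+ 2 + 2 * normc w ^+ 2.
Proof.
rewrite !normc_sq !raddfD/=.
move: (complex.Re z) (complex.Re w) (complex.Im z) (complex.Im w) => x u y v.
by have := sqr_ge0 (x - u); have := sqr_ge0 (y - v); lra.
Qed.

Definition cmeasurable f := measurable_fun D (fun x => complex.Re (f x)) /\
  measurable_fun D (fun x => complex.Im (f x)).

(** The squared L^2 norm. Its quasi-triangle inequality [energyD] plays the
    role of Minkowski's inequality in the density arguments. *)
Definition energy f : \bar R := \int[mu]_(x in D) (normc (f x) ^+ 2)%:E.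

Lemma L2P f : L2 mu D f <-> cmeasurable f /\ (energy f < +oo)%E.
Proof. by split=> [[]|[[]]]. Qed.

Lemma measurable_normc_sq f : cmeasurable f ->
  measurable_fun D (fun x => (normc (f x) ^+ 2)%:E).
Proof.
move=> [mr mi]; apply/measurable_EFinP.
under eq_fun do rewrite normc_sq.
by apply: measurable_funD; exact: measurable_funX.
Qed.

Lemma cmeasurableD f g : cmeasurable f -> cmeasurable g ->
  cmeasurable (fun x => f x + g x).
Proof.
move=> [f1 f2] [g1 g2]; split; under eq_fun do rewrite raddfD/=;
  exact: measurable_funD.
Qed.

Lemma cmeasurableZ c f : cmeasurable f -> cmeasurable (fun x => c * f x).
Proof.
case: c => a b [f1 f2]; split.
- rewrite (_ : (fun x => _) =
    (fun x => a * complex.Re (f x) - b * complex.Im (f x))); last first.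
    by apply/funext => x; case: (f x).
  by apply: measurable_funB; exact: measurable_funM.
- rewrite (_ : (fun x => _) =
    (fun x => a * complex.Im (f x) + b * complex.Re (f x))); last first.
    by apply/funext => x; case: (f x).
  by apply: measurable_funD; exact: measurable_funM.
Qed.

Lemma energy_ge0 f : (0 <= energy f)%E.
Proof. by apply: integral_ge0 => x _; rewrite lee_fin sqr_ge0. Qed.

Lemma energyD f g : cmeasurable f -> cmeasurable g ->
  (energy (fun x => (f x + g x)%R) <= 2%:E * energy f + 2%:E * energy g)%E.
Proof.
move=> mf mg; rewrite /energy.
have h0 h x : D x -> (0 <= (normc (h x) ^+ 2)%:E :> \bar R)%E.
  by rewrite lee_fin sqr_ge0.
have mh h : cmeasurable h ->
    measurable_fun D (fun x => 2%:E * (normc (h x) ^+ 2)%:E : \bar R)%E.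
  by move=> /measurable_normc_sq ?; exact: measurable_funeM.
rewrite -!ge0_integralZl//; [|exact: measurable_normc_sq|exact: (h0 g)
  |exact: measurable_normc_sq|exact: (h0 f)].
have h2 h x : D x -> (0 <= 2%:E * (normc (h x) ^+ 2)%:E :> \bar R)%E.
  by rewrite -EFinM lee_fin mulr_ge0// sqr_ge0.
rewrite -ge0_integralD//; [|exact: (h2 f)|exact: mh|exact: (h2 g)|exact: mh].
apply: ge0_le_integral => //.
- exact: (h0 (fun x => f x + g x)).
- exact: (measurable_normc_sq (cmeasurableD mf mg)).
- by apply: emeasurable_funD; exact: mh.
- by move=> x Dx; rewrite -!EFinM -EFinD lee_fin; exact: normc_sqD.
Qed.

Lemma energyZ c f : cmeasurable f ->
  (energy (fun x => (c * f x)%R) = (normc c ^+ 2)%:E * energy f)%E.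
Proof.
move=> mf; rewrite /energy -ge0_integralZl//.
- by apply: eq_integral => x _; rewrite ComplexField.Normc.normcM exprMn.
- exact: measurable_normc_sq.
- by move=> x _; rewrite lee_fin sqr_ge0.
- by rewrite lee_fin sqr_ge0.
Qed.

Lemma L2D f g : L2 mu D f -> L2 mu D g -> L2 mu D (fun x => f x + g x).
Proof.
move=> /L2P[mf fy] /L2P[mg gy]; apply/L2P; split; first exact: cmeasurableD.
apply: le_lt_trans (energyD mf mg) _.
by apply: lte_add_pinfty; apply: lte_mul_pinfty.
Qed.

Lemma L2Z c f : L2 mu D f -> L2 mu D (fun x => c * f x).
Proof.
move=> /L2P[mf fy]; apply/L2P; split; first exact: cmeasurableZ.
by rewrite energyZ// lte_mul_pinfty// lee_fin sqr_ge0.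
Qed.

Lemma L20 : L2 mu D (fun=> 0).
Proof.
apply/L2P; split; first by split; exact: measurable_cst.
by rewrite /energy; under eq_integral do rewrite /= expr0n/= addr0 sqrtr0 expr0n;
  rewrite integral0 ltry.
Qed.

Lemma L2_sum (I : Type) (s : seq I) (F : I -> T -> R[i]) :
  (forall i, L2 mu D (F i)) -> L2 mu D (fun x => \sum_(i <- s) F i x).
Proof.
move=> LF; elim: s => [|i s IH].
  by under eq_fun do rewrite big_nil; exact: L20.
by under eq_fun do rewrite big_cons; exact: L2D.
Qed.

Lemma L2B f g : L2 mu D f -> L2 mu D g -> L2 mu D (fun x => f x - g x).
Proof.
move=> Lf Lg; have := L2D Lf (L2Z (-1) Lg).
by under eq_fun do rewrite mulN1r.
Qed.

(** The real and imaginary parts of the product of z and the conjugate of w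
    are bounded by |z|^2 + |w|^2. *)
Lemma L2dot_integrable f g : L2 mu D f -> L2 mu D g ->
  mu.-integrable D (EFin \o (fun x => complex.Re (f x * (g x)^*))) /\
  mu.-integrable D (EFin \o (fun x => complex.Im (f x * (g x)^*))).
Proof.
move=> /L2P[mf fy] /L2P[mg gy].
have ih : mu.-integrable D
    (fun x => (normc (f x) ^+ 2)%:E + (normc (g x) ^+ 2)%:E)%E.
  apply: integrableD => //; apply/integrableP; (split; first exact: measurable_normc_sq);
    by under eq_integral do rewrite gee0_abs ?lee_fin ?sqr_ge0//.
have [[f1 f2] [g1 g2]] := (mf, mg).
split; apply: le_integrable ih => //.
- apply/measurable_EFinP; rewrite (_ : (fun x => _) = (fun x =>
    complex.Re (f x) * complex.Re (g x) + complex.Im (f x) * complex.Im (g x))).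
    by apply: measurable_funD; exact: measurable_funM.
  by apply/funext => x; case: (f x) (g x) => u v [w z] /=; rewrite mulrN opprK.
- move=> x Dx; rewrite -EFinD !abse_EFin lee_fin [leRHS]ger0_norm ?addr_ge0 ?sqr_ge0//.
  rewrite !normc_sq; case: (f x) (g x) => u v [w z] /=.
  have := sqr_ge0 (u - w); have := sqr_ge0 (u + w).
  have := sqr_ge0 (v - z); have := sqr_ge0 (v + z).
  by rewrite ler_norml => *; apply/andP; split; lra.
- apply/measurable_EFinP; rewrite (_ : (fun x => _) = (fun x =>
    complex.Im (f x) * complex.Re (g x) - complex.Re (f x) * complex.Im (g x))).
    by apply: measurable_funB; exact: measurable_funM.
  by apply/funext => x; case: (f x) (g x) => u v [w z] /=; rewrite mulrN addrC.
- move=> x Dx; rewrite -EFinD !abse_EFin lee_fin [leRHS]ger0_norm ?addr_ge0 ?sqr_ge0//.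
  rewrite !normc_sq; case: (f x) (g x) => u v [w z] /=.
  have := sqr_ge0 (u - z); have := sqr_ge0 (u + z).
  have := sqr_ge0 (v - w); have := sqr_ge0 (v + w).
  by rewrite ler_norml => *; apply/andP; split; lra.
Qed.

Lemma L2dotDl f g h : L2 mu D f -> L2 mu D g -> L2 mu D h ->
  L2dot mu D (fun x => f x + g x) h = L2dot mu D f h + L2dot mu D g h.
Proof.
move=> Lf Lg Lh; rewrite /L2dot.
have [i1 i2] := L2dot_integrable Lf Lh; have [j1 j2] := L2dot_integrable Lg Lh.
rewrite -[RHS]/((_ + _) +i* (_ + _)) -!RintegralD//.
by congr (_ +i* _); apply: eq_Rintegral => x _; rewrite mulrDl raddfD.
Qed.

Lemma L2dotZl c f h : L2 mu D f -> L2 mu D h ->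
  L2dot mu D (fun x => c * f x) h = c * L2dot mu D f h.
Proof.
move=> Lf Lh; rewrite /L2dot.
have [i1 i2] := L2dot_integrable Lf Lh.
case: c => a b; rewrite -[RHS]/((_ - _) +i* (_ + _)) -!RintegralZl//.
have iZ (k : R) F : mu.-integrable D (EFin \o F) ->
    mu.-integrable D (EFin \o (fun x => k * F x)).
  by move=> iF; have := integrableZl mD k iF.
rewrite -RintegralB//; [|exact: iZ..]; rewrite -RintegralD//; [|exact: iZ..].
by congr (_ +i* _); apply: eq_Rintegral => x _; rewrite -mulrA; case: (_ * _^*).
Qed.

Lemma L2dotC f g : L2 mu D f -> L2 mu D g ->
  L2dot mu D g f = (L2dot mu D f g)^*.
Proof.
move=> Lf Lg; rewrite /L2dot /= -mulN1r -RintegralZl//; last first.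
  by have [] := L2dot_integrable Lf Lg.
congr (_ +i* _); apply: eq_Rintegral => x _;
  by case: (f x) (g x) => u v [w z] /=; ring.
Qed.

Lemma L2dot_suml (I : Type) (s : seq I) (F : I -> T -> R[i]) h :
  (forall i, L2 mu D (F i)) -> L2 mu D h ->
  L2dot mu D (fun x => \sum_(i <- s) F i x) h = \sum_(i <- s) L2dot mu D (F i) h.
Proof.
move=> LF Lh; elim: s => [|i s IH].
  rewrite big_nil; under [fun x => _]funext do rewrite big_nil.
  rewrite /L2dot; under eq_Rintegral do rewrite mul0r/=.
  under [X in _ +i* X]eq_Rintegral do rewrite mul0r/=.
  by rewrite /Rintegral integral0.
rewrite big_cons -IH -L2dotDl//; last exact: L2_sum.
by under [fun x => _]funext do rewrite big_cons.
Qed.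

End L2_theory.

(** * Mean-square approximation by finite linear combinations *)

Section approximation.
Context d (T : measurableType d) (R : realType).
Variables (mu : {measure set T -> \bar R}) (D : set T) (mD : measurable D).
Variables (I : eqType) (e : I -> T -> R[i]).
Hypothesis Le : forall i, L2 mu D (e i).
Implicit Types (f g : T -> R[i]) (c : R[i]).

(** Coefficients are attached to the entries of the list, with repeated
    indices allowed, so that sums and multiples of combinations are obtained by
    concatenating and mapping. *)
Definition lincomb (l : seq (I * R[i])) : T -> R[i] :=
  fun x => \sum_(v <- l) v.2 * e v.1 x.

Definition approximable f := forall eps : R, 0 < eps ->
  exists l, (energy mu D (fun x => (f x - lincomb l x)%R) <= eps%:E)%E.

Lemma L2_lincomb l : L2 mu D (lincomb l).
Proof. by apply: L2_sum => // i; exact: L2Z. Qed.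

Lemma L2_cmeasurable f : L2 mu D f -> cmeasurable D f.
Proof. by case. Qed.

Lemma cmeasurableB f g : cmeasurable D f -> cmeasurable D g ->
  cmeasurable D (fun x => f x - g x).
Proof.
move=> mf mg; have := cmeasurableD mf (cmeasurableZ (-1) mg).
by under eq_fun do rewrite mulN1r.
Qed.

Lemma energy0 : energy mu D (fun=> 0) = 0%E.
Proof.
by rewrite /energy; under eq_integral do
  rewrite /= expr0n/= addr0 sqrtr0 expr0n; rewrite integral0.
Qed.

Lemma approximable_lincomb l : approximable (lincomb l).
Proof.
move=> eps eps0; exists l; under [fun x => _]funext do rewrite subrr.
by rewrite energy0 lee_fin ltW.
Qed.

Lemma approximable_limit f : cmeasurable D f ->
  (forall eps : R, 0 < eps -> exists g, [/\ cmeasurable D g, approximable g &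
     (energy mu D (fun x => (f x - g x)%R) <= eps%:E)%E]) ->
  approximable f.
Proof.
move=> mf fa eps eps0; have e4 : 0 < eps / 4 by rewrite divr_gt0.
have [g [mg ag fg]] := fa _ e4; have [l gl] := ag _ e4; exists l.
rewrite (_ : (fun x => _) = (fun x => (f x - g x) + (g x - lincomb l x))); last first.
  by apply/funext => x; rewrite addrA subrK.
have ml := L2_cmeasurable (L2_lincomb l).
apply: le_trans (energyD mu mD (cmeasurableB mf mg) (cmeasurableB mg ml)) _.
apply: (@le_trans _ _ (2%:E * (eps / 4)%:E + 2%:E * (eps / 4)%:E)%E).
  by apply: leeD; apply: lee_wpmul2l => //; rewrite lee_fin.
by rewrite -!EFinM -EFinD lee_fin; lra.
Qed.

Lemma approximableD f g : cmeasurable D f -> cmeasurable D g ->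
  approximable f -> approximable g -> approximable (fun x => f x + g x).
Proof.
move=> mf mg fa ga eps eps0; have e4 : 0 < eps / 4 by rewrite divr_gt0.
have [l fl] := fa _ e4; have [l' gl] := ga _ e4; exists (l ++ l').
rewrite (_ : (fun x => _) =
    (fun x => (f x - lincomb l x) + (g x - lincomb l' x))); last first.
  by apply/funext => x; rewrite /lincomb big_cat/= opprD addrACA.
have ml k := L2_cmeasurable (L2_lincomb k).
apply: le_trans
  (energyD mu mD (cmeasurableB mf (ml l)) (cmeasurableB mg (ml l'))) _.
apply: (@le_trans _ _ (2%:E * (eps / 4)%:E + 2%:E * (eps / 4)%:E)%E).
  by apply: leeD; apply: lee_wpmul2l => //; rewrite lee_fin.
by rewrite -!EFinM -EFinD lee_fin; lra.
Qed.

Lemma approximableZ c f : cmeasurable D f ->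
  approximable f -> approximable (fun x => c * f x).
Proof.
move=> mf fa eps eps0.
have c0 : 0 < normc c ^+ 2 + 1 by rewrite ltr_wpDl// sqr_ge0.
have [l fl] := fa (eps / (normc c ^+ 2 + 1)) (divr_gt0 eps0 c0).
exists [seq (v.1, c * v.2) | v <- l].
rewrite (_ : (fun x => _) = (fun x => c * (f x - lincomb l x))); last first.
  apply/funext => x; rewrite mulrBr; congr (_ - _).
  by rewrite /lincomb big_map mulr_sumr; apply: eq_bigr => v _; rewrite mulrA.
have ml := L2_cmeasurable (L2_lincomb l).
rewrite energyZ//; last exact: cmeasurableB.
apply: (@le_trans _ _ ((normc c ^+ 2)%:E * (eps / (normc c ^+ 2 + 1))%:E)%E).
  by apply: lee_wpmul2l => //; rewrite lee_fin sqr_ge0.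
rewrite -EFinM lee_fin mulrCA ler_piMr// ?ltW//.
by rewrite ltr_pdivrMr// mul1r ltrDl.
Qed.

Lemma approximable0 : approximable (fun=> 0).
Proof.
have := approximable_lincomb [::].
by rewrite /lincomb; under [fun x => _]funext do rewrite big_nil.
Qed.

Lemma approximable_sum (J : Type) (s : seq J) (F : J -> T -> R[i]) :
  (forall j, cmeasurable D (F j)) -> (forall j, approximable (F j)) ->
  approximable (fun x => \sum_(j <- s) F j x).
Proof.
move=> mF aF.
suff [] : cmeasurable D (fun x => \sum_(j <- s) F j x) /\
    approximable (fun x => \sum_(j <- s) F j x) by [].
elim: s => [|j s [IH1 IH2]].
  under [fun x => _]funext do rewrite big_nil.
  by split; [exact: L2_cmeasurable (L20 _ _)|exact: approximable0].
under [fun x => _]funext do rewrite big_cons.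
by split; [exact: cmeasurableD|exact: approximableD].
Qed.

(** Since |f - F n|^2 <= 4 |f|^2, dominated convergence turns the pointwise
    limit into a mean-square limit. *)
Lemma approximable_dominated f (F : nat -> T -> R[i]) : L2 mu D f ->
  (forall n, cmeasurable D (F n)) -> (forall n, approximable (F n)) ->
  {ae mu, forall x, D x -> normc (f x - F n x) ^+ 2 @[n --> \oo] --> (0 : R)} ->
  (forall n x, D x -> normc (F n x) ^+ 2 <= normc (f x) ^+ 2) ->
  approximable f.
Proof.
move=> /L2P[mf fy] mF aF Ff dF; apply: approximable_limit => // eps eps0.
pose h n x := (normc (f x - F n x) ^+ 2)%:E.
pose g x := (4%:E * (normc (f x) ^+ 2)%:E)%E.
have [|||||_ _ hlim] := @dominated_convergence _ _ _ mu D mD h (cst 0%E) g.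
- by move=> n; exact: measurable_normc_sq (cmeasurableB mf (mF n)).
- exact: measurable_cst.
- apply: filterS Ff => x Fx Dx; rewrite /h/=.
  by apply: cvg_EFin; [exact: nearW|exact: Fx].
- apply: integrableZl => //; apply/integrableP; split; first exact: measurable_normc_sq.
  by under eq_integral do rewrite gee0_abs ?lee_fin ?sqr_ge0//.
- apply: aeW => x n Dx; rewrite gee0_abs ?lee_fin ?sqr_ge0//.
  have := normc_sqD (f x) (- F n x).
  have -> : normc (- F n x) ^+ 2 = normc (F n x) ^+ 2.
    by rewrite !normc_sq !raddfN/= !sqrrN.
  by have := dF n x Dx; lra.
rewrite integral0 in hlim.
have [n hn] : exists n, (\int[mu]_(x in D) h n x < eps%:E)%E.
  suff : \forall n \near \oo, (\int[mu]_(x in D) h n x < eps%:E)%E by move=> /filter_ex.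
  apply: (hlim [set x | (x < eps%:E)%E]); apply: open_nbhs_nbhs.
  by split; [exact: open_ereal_lt_ereal|rewrite /= lte_fin].
by exists (F n); split=> //; exact: ltW.
Qed.

(** The multiple occurrences of an index in the list are collected into one
    coefficient. *)
Lemma dense_span_approximable :
  (forall f, L2 mu D f -> approximable f) -> dense_span mu D e.
Proof.
move=> all_approx f Lf eps eps0.
(* eps^2 / 2 makes the final inequality strict. *)
have e2 : 0 < eps ^+ 2 / 2 by rewrite divr_gt0// exprn_gt0.
have [l fl] := all_approx f Lf _ e2.
exists (undup [seq v.1 | v <- l]), (fun i => \sum_(v <- l | v.1 == i) v.2).
have -> : (fun x => f x - \sum_(i <- undup [seq v.1 | v <- l])
    (\sum_(v <- l | v.1 == i) v.2) * e i x) = (fun x => f x - lincomb l x).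
  apply/funext => x; congr (_ - _); rewrite /lincomb.
  under eq_bigr do rewrite mulr_suml.
  under eq_bigr do rewrite big_mkcond.
  rewrite exchange_big/= [in LHS]big_seq [in RHS]big_seq; apply: eq_bigr => v vl.
  rewrite (bigD1_seq v.1)/= ?undup_uniq//; last first.
    by rewrite mem_undup; apply/mapP; exists v.
  by rewrite eqxx big1 ?addr0// => i /negPf; rewrite eq_sym => ->.
rewrite /L2norm -/(energy mu D _).
have : (energy mu D (fun x => (f x - lincomb l x)%R) < (eps ^+ 2)%:E)%E.
  by apply: le_lt_trans fl _; rewrite lte_fin ltr_pdivrMr// ltr_pMr ?exprn_gt0// ltr1n.
have := energy_ge0 mu D (fun x => (f x - lincomb l x)%R).
case: (energy _ _ _) => [r| |]//; rewrite lee_fin lte_fin => r0 re.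
rewrite poweR_EFin lte_fin -[ltRHS]ger0_norm ?(ltW eps0)// -sqrtr_sqr.
by rewrite powR12_sqrt// ltr_sqrt// exprn_gt0.
Qed.

End approximation.

(** * Families that agree almost everywhere *)

Section ae_transfer.
Context d (T : measurableType d) (R : realType).
Variables (mu : {measure set T -> \bar R}) (D : set T) (mD : measurable D).
Implicit Types (f g : T -> R[i]).

Lemma energy_ae f g : cmeasurable D f -> cmeasurable D g ->
  {ae mu, forall x, D x -> f x = g x} -> energy mu D f = energy mu D g.
Proof.
move=> mf mg fg; apply: ae_eq_integral => //; [exact: measurable_normc_sq..|].
by apply: filterS fg => x fg /fg ->.
Qed.

Lemma L2dot_ae f g f' g' : L2 mu D f -> L2 mu D g -> L2 mu D f' -> L2 mu D g' ->
  {ae mu, forall x, D x -> f x = f' x} -> {ae mu, forall x, D x -> g x = g' x} ->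
  L2dot mu D f g = L2dot mu D f' g'.
Proof.
move=> Lf Lg Lf' Lg' ff' gg'.
have [/measurable_int m1 /measurable_int m2] := L2dot_integrable mD Lf Lg.
have [/measurable_int m3 /measurable_int m4] := L2dot_integrable mD Lf' Lg'.
rewrite /L2dot /Rintegral; congr (fine _ +i* fine _);
  by apply: ae_eq_integral => //; apply: filterS2 ff' gg' => x ff gg Dx;
     rewrite /= ff// gg.
Qed.

Lemma orthonormal_basis_ae (I : eqType) (e e' : I -> T -> R[i]) :
  (forall i, L2 mu D (e' i)) ->
  (forall i, {ae mu, forall x, D x -> e i x = e' i x}) ->
  orthonormal_basis mu D e -> orthonormal_basis mu D e'.
Proof.
move=> Le' ee' [Le oe de]; split=> //.
  by move=> i j; rewrite -oe; apply/esym/L2dot_ae.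
move=> f Lf eps /(de f Lf)[s [c fsc]]; exists s, c.
move: fsc; rewrite /L2norm -!/(energy mu D _).
have L2s (h : I -> T -> R[i]) : (forall i, L2 mu D (h i)) ->
    L2 mu D (fun x => \sum_(i <- s) c i * h i x).
  by move=> Lh; apply: L2_sum => // i; exact: L2Z.
rewrite (@energy_ae _ (fun x => f x - \sum_(i <- s) c i * e' i x)) //.
- exact: L2_cmeasurable (L2B mD Lf (L2s _ Le)).
- exact: L2_cmeasurable (L2B mD Lf (L2s _ Le')).
- suff : {ae mu, forall x, D x ->
      \sum_(i <- s) c i * e i x = \sum_(i <- s) c i * e' i x}.
    by apply: filterS => x h /h ->.
  elim: s {L2s} => [|i s IH]; first by apply: aeW => x _; rewrite !big_nil.
  by apply: filterS2 (ee' i) IH => x hi hs Dx; rewrite !big_cons hi// hs.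
Qed.

End ae_transfer.

(** * Base-N expansions, the core of the fractal, and cells *)

Lemma exp_inv_lt (R : realType) (N : nat) (eps : R) : (1 < N)%N -> 0 < eps ->
  exists n, (N%:R ^+ n)^-1 < eps.
Proof.
move=> N1 eps0; have N0 : 0 < N%:R :> R by rewrite ltr0n (ltn_trans _ N1).
have : N%:R^-1 ^+ n @[n --> \oo] --> (0 : R).
  by apply: cvg_expr; rewrite normfV gtr0_norm// invf_lt1// ltr1n.
move=> /cvgr0Pnorm_lt /(_ _ eps0)[n _ /(_ n)/=]; rewrite leqnn => /(_ isT).
by rewrite normrX normfV gtr0_norm// exprVn; exists n.
Qed.

Section expansion.
Context {R : realType} (N : nat) (a : seq nat).
Hypothesis N2 : (2 <= N)%N.
Hypothesis aN : {in a, forall d, (d < N)%N}.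
Implicit Types (x y : R) (d : nat -> nat).

Local Notation C := (@fractal R N a).

(** The integer with base-N digits d 0, ..., d (n - 1), most significant
    first. *)
Fixpoint prefix_value d n : nat :=
  if n is m.+1 then (N * prefix_value d m + d m)%N else 0%N.

Let N_gt0 : (0 < N)%N. Proof. exact: ltn_trans N2. Qed.
Let NR_gt0 : 0 < N%:R :> R. Proof. by rewrite ltr0n. Qed.
Let NR_neq0 : N%:R != 0 :> R. Proof. exact: lt0r_neq0. Qed.
Let NX_gt0 n : 0 < N%:R ^+ n :> R. Proof. exact: exprn_gt0. Qed.

Lemma partial_sumE d n : \sum_(1 <= j < n.+1) (d j)%:R / N%:R ^+ j =
  (prefix_value (fun j => d j.+1) n)%:R / N%:R ^+ n :> R.
Proof.
elim: n => [|n IH]; first by rewrite big_geq// mul0r.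
rewrite big_nat_recr//= IH natrD natrM exprS; field.
by rewrite NR_neq0 expf_neq0.
Qed.

Lemma prefix_bounds d n k : (forall j, d j \in a) ->
  (prefix_value d n * N ^ k <= prefix_value d (k + n) < (prefix_value d n).+1 * N ^ k)%N.
Proof.
move=> da; elim: k => [|k /andP[IH1 IH2]]; first by rewrite !muln1 add0n leqnn ltnSn.
rewrite addSn/= expnS; have := aN (da (k + n)%N); move: (d _) => e eN.
by apply/andP; split; nia.
Qed.

(** The truncations increase, and N^n times any later truncation stays in
    [prefix_value d n, prefix_value d n + 1]. *)
Lemma expansion_ex d : (forall j, d j \in a) -> exists x,
  (prefix_value d n)%:R / N%:R ^+ n @[n --> \oo] --> x /\
  forall n, (prefix_value d n)%:R <= N%:R ^+ n * x <= (prefix_value d n)%:R + 1.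
Proof.
move=> da; pose u n : R := (prefix_value d n)%:R / N%:R ^+ n.
have uE n k : N%:R ^+ n * u (k + n)%N = (prefix_value d (k + n))%:R / N%:R ^+ k.
  rewrite /u exprD; field.
  by rewrite !expf_neq0.
have vb n k : (prefix_value d n)%:R <= N%:R ^+ n * u (k + n)%N <= (prefix_value d n)%:R + 1.
  have /andP[h1 h2] := prefix_bounds n k da.
  rewrite uE ler_pdivlMr// ler_pdivrMr// natr1 -natrX -!natrM !ler_nat h1.
  exact: ltnW.
have ud : nondecreasing_seq u.
  apply/nondecreasing_seqP => n; have /andP[h _] := vb n 1%N.
  by rewrite /u ler_pdivrMr// mulrC.
have cu : cvgn u.
  apply: nondecreasing_is_cvgn => //; exists 1 => _ [n _ <-].
  by have := vb 0%N n; rewrite addn0 expr0 mul1r add0r => /andP[].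
exists (limn u); split=> [//|n].
have cv : N%:R ^+ n * u (k + n)%N @[k --> \oo] --> N%:R ^+ n * limn u.
  by apply: cvgMr; rewrite cvg_shiftn.
rewrite -(cvg_lim _ cv)//; apply/andP; split.
- by apply: limr_ge; [exact: cvgP cv|apply: nearW => k; have /andP[] := vb n k].
- by apply: limr_le; [exact: cvgP cv|apply: nearW => k; have /andP[] := vb n k].
Qed.

Lemma cvg_prefix d x :
  (forall n, (prefix_value d n)%:R <= N%:R ^+ n * x <= (prefix_value d n)%:R + 1) ->
  (prefix_value d n)%:R / N%:R ^+ n @[n --> \oo] --> x.
Proof.
move=> h; apply: (@squeeze_cvgr _ _ _ _ (fun n => x - N%:R^-1 ^+ n) (fun=> x)).
- apply: nearW => n; have /andP[h1 h2] := h n.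
  apply/andP; split; last by rewrite ler_pdivrMr// mulrC.
  by rewrite exprVn ler_pdivlMr// mulrBl mulVf ?expf_neq0// mulrC lerBlDr.
- rewrite -[X in _ --> X]subr0; apply: cvgB; first exact: cvg_cst.
  by apply: cvg_expr; rewrite ger0_norm ?invr_ge0 ?ltW// invf_lt1// ltr1n.
- exact: cvg_cst.
Qed.

(** Membership in the fractal without limits: at every scale N^n the point
    lies in the closed unit interval attached to the first n digits. *)
Lemma fractalP x : C x <-> exists2 d, (forall j, d j \in a) &
  forall n, (prefix_value d n)%:R <= N%:R ^+ n * x <= (prefix_value d n)%:R + 1.
Proof.
split=> [[d da dx]|[d da dx]].
  have da' j : d j.+1 \in a by exact: da.
  exists (fun j => d j.+1) => //.
  have [y [uy yb]] := expansion_ex da'; suff -> : x = y by [].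
  apply: cvg_unique uy => //; move: dx; rewrite -(cvg_shiftn 1).
  by rewrite /=; under eq_fun do rewrite addn1 partial_sumE.
exists (fun j => d j.-1) => [j _|]; first exact: da.
rewrite -(cvg_shiftn 1)/=; under eq_fun do rewrite addn1 partial_sumE.
exact: cvg_prefix.
Qed.

Definition level n x : int := Num.floor (N%:R ^+ n * x).

Definition digit_at n x := exists2 e, e \in a & level n.+1 x = N%:Z * level n x + e%:Z.

(** The points of [0, 1) whose floor expansion (the one without a tail of
    digits N - 1) uses only digits from a. Unlike the fractal, its integer
    translates are disjoint and its self-similar pieces do not overlap. *)
Definition core : set R := [set x | level 0 x = 0 /\ forall n, digit_at n x].

Lemma level_shift n x (e : nat) :
  level n (N%:R * x - e%:R) = level n.+1 x - (e * N ^ n)%:Z.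
Proof.
rewrite /level mulrBr mulrA -exprSr floorDrz; last first.
  by rewrite -natrX -natrM rpredN natr_int.
congr (_ + _); rewrite -natrX -natrM mulnC.
by rewrite (_ : - _ = (- (e * N ^ n)%:Z)%:~R) ?intrKfloor// rmorphN.
Qed.

(** Exact self-similarity: multiplying by N and removing the first digit
    shifts the floor expansion. *)
Lemma core_split x : core x <-> exists2 e, e \in a & core (N%:R * x - e%:R).
Proof.
split=> [[x0 xa]|[e ea [x0 xa]]].
  have [e ea x1] := xa 0%N; exists e => //; split.
    by rewrite level_shift x1 x0; lia.
  move=> n; have [f fa xn] := xa n.+1; exists f => //.
  by rewrite !level_shift xn expnS; lia.
have x1 : level 1 x = e by have := x0; rewrite level_shift; lia.
have x00 : level 0 x = 0.
  apply/eqP; rewrite /level expr0 mul1r floor_eq.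
  have := floor_itv (N%:R ^+ 1 * x); rewrite -/(level 1 x) x1 expr1.
  have eN : e%:R + 1 <= N%:R :> R by rewrite natr1 ler_nat aN.
  have e0 := ler0n R e; rewrite -pmulrn intrD -pmulrn => /andP[h1 h2].
  by rewrite mulr0z add0r mulr1z; apply/andP; split;
    rewrite -(ler_pM2l NR_gt0, ltr_pM2l NR_gt0) ?mulr0 ?mulr1; lra.
split=> // -[|n]; first by exists e => //; rewrite x1 x00; lia.
have [f fa] := xa n; rewrite !level_shift expnS => h; exists f => //.
by rewrite -(subrK (e * (N * N ^ n))%:Z (level _ x)) h; lia.
Qed.

Lemma core_prefix d x :
  (forall n, level n x = prefix_value d n) -> (forall j, d j \in a) -> core x.
Proof.
move=> xd da; split=> [|n]; first by rewrite xd.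
by exists (d n) => //; rewrite !xd/=; lia.
Qed.

Lemma core_fractal : core `<=` C.
Proof.
move=> x [x0 xa]; have {xa} [d dP] : exists d : nat -> nat, forall n, d n \in a /\
    level n.+1 x = N%:Z * level n x + d n.
  have /choice[d dP] : forall n, exists e, e \in a /\
      level n.+1 x = N%:Z * level n x + e%:Z.
    by move=> n; have [e ? ?] := xa n; exists e.
  by exists d.
apply/fractalP; exists d => [j|n]; first by have [] := dP j.
have xd : level n x = prefix_value d n.
  by elim: n => [//|n IH]; have [_ ->] := dP n; rewrite IH/=; lia.
have := floor_itv (N%:R ^+ n * x); rewrite -/(level n x) xd intrD.
by move=> /andP[-> /ltW].
Qed.

(** A point of the fractal that is never the right end of its intervals has
    the given digits as floor digits; the other points are quotients of an
    integer by a power of N. *)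
Lemma fractal_core_countable : countable (C `\` core).
Proof.
pose f (v : nat * nat) : R := v.1%:R / N%:R ^+ v.2.
have cf : countable (range f).
  exact: sub_countable (card_image_le f setT) (countableP _).
apply: sub_countable cf; apply: subset_card_le => x [/fractalP[d da dx] ncx].
have [[n dn]|ndn] := pselect (exists n, N%:R ^+ n * x = (prefix_value d n)%:R + 1).
  exists ((prefix_value d n).+1, n) => //.
  by rewrite /f/= -natr1 -dn mulrAC divff ?mul1r ?expf_neq0.
case: ncx; apply: (@core_prefix d) => // n; apply/eqP; rewrite floor_eq intrD.
have /andP[h1 h2] := dx n; rewrite -pmulrn h1/= mulr1z lt_neqAle h2 andbT.
by apply/eqP => h; apply: ndn; exists n.
Qed.

Lemma level_itv n (m : int) : [set x | level n x = m] =
  `[m%:~R / N%:R ^+ n, (m + 1)%:~R / N%:R ^+ n[%classic.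
Proof.
apply/seteqP; split=> x /=; rewrite in_itv/= ler_pdivrMr// ltr_pdivlMr// mulrC -floor_eq.
  by move=> /eqP.
by move/eqP.
Qed.

Lemma level_measurable n (m : int) :
  measurable ([set x | level n x = m] : set (measurableTypeR R)).
Proof. by rewrite level_itv; exact: measurable_itv. Qed.

Lemma core_measurable : measurable (core : set (measurableTypeR R)).
Proof.
rewrite (_ : core = [set x | level 0 x = 0] `&` \bigcap_n [set x | digit_at n x]); last first.
  by apply/seteqP; split=> x [h1 h2]; split=> // n; [move=> _; exact: h2|exact: (h2 n)].
apply: measurableI; first exact: level_measurable.
apply: bigcapT_measurable => n.
rewrite (_ : [set x | _] = \bigcup_(v : nat * int) if v.1 \in a then
   [set x | level n.+1 x = N%:Z * v.2 + v.1%:Z] `&` [set x | level n x = v.2] else set0).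
  apply: countable_bigcupT_measurable => // v; case: ifP => // _.
  by apply: measurableI; exact: level_measurable.
apply/seteqP; split=> [x [e ea xe]|x [[e m] _]].
  by exists (e, level n x) => //=; rewrite ea.
by case: ifP => //= ea [xe xm]; exists e => //; rewrite xm.
Qed.

Lemma fractal_measurable : measurable (C : set (measurableTypeR R)).
Proof.
rewrite (_ : C = core `|` (C `\` core)).
  apply: measurableU; first exact: core_measurable.
  by apply: countable_measurable fractal_core_countable => t; exact: measurable_set1.
by rewrite setDUK//; exact: core_fractal.
Qed.

(** The core counterpart of the set N^(-q) (C + k). *)
Definition cell (q k : int) : set R := [set x | core (N%:R ^ q * x - k%:~R)].

Lemma cell_split q k x :
  cell q k x <-> exists2 e, e \in a & cell (q + 1) (N%:Z * k + e%:Z) x.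
Proof.
rewrite /cell/= core_split; suff h (e : nat) : N%:R * (N%:R ^ q * x - k%:~R) - e%:R =
    N%:R ^ (q + 1) * x - (N%:Z * k + e%:Z)%:~R.
  by split=> -[e ea ce]; exists e => //; move: ce; rewrite h.
by rewrite expfzDr// expr1z mulrBr mulrA [N%:R * _]mulrC intrD intrM opprD addrA.
Qed.

Lemma cell_floor q k x : cell q k x -> Num.floor (N%:R ^ q * x) = k.
Proof.
move=> [+ _]; rewrite /level expr0 mul1r floorDrz ?rpredN ?intr_int//.
by rewrite -rmorphN intrKfloor => /eqP; rewrite subr_eq0 => /eqP.
Qed.

Lemma floor_mulN x y : Num.floor (N%:R * x) = Num.floor (N%:R * y) ->
  Num.floor x = Num.floor y.
Proof.
have le (u v : R) : Num.floor (N%:R * u) = Num.floor (N%:R * v) ->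
    Num.floor u <= Num.floor v.
  move=> uv; rewrite floor_ge_int -(ler_pM2l NR_gt0).
  rewrite (_ : _ * _%:~R = (N%:Z * Num.floor u)%:~R); last by rewrite intrM.
  by rewrite -floor_ge_int -uv floor_ge_int intrM ler_pM2l// floor_le.
by move=> xy; apply/eqP; rewrite eq_le !le.
Qed.

Lemma level_coarsen n (j : nat) x y :
  Num.floor (N%:R ^ (n%:Z + j%:Z) * x) = Num.floor (N%:R ^ (n%:Z + j%:Z) * y) ->
  level n x = level n y.
Proof.
elim: j => [|j IH]; first by rewrite addr0.
rewrite -addn1 PoszD addrA expfzDr// expr1z ![_ * N%:R]mulrC -!mulrA.
by move=> /floor_mulN.
Qed.

(** A generation-q cell lies in a single interval of generation n <= q. *)
Lemma cell_level n (j : nat) k x y : cell (n%:Z + j%:Z) k x -> cell (n%:Z + j%:Z) k y ->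
  level n x = level n y.
Proof. by move=> /cell_floor xk /cell_floor; rewrite -xk => /esym/level_coarsen. Qed.

Let affine_measurable (q k : int) : measurable_fun setT
  ((fun x => N%:R ^ q * x - k%:~R) : measurableTypeR R -> measurableTypeR R).
Proof. by apply: measurable_funB => //; exact: measurable_funM. Qed.

Lemma cell_measurable q k : measurable (cell q k : set (measurableTypeR R)).
Proof.
by rewrite -[X in measurable X]setTI; exact: affine_measurable core_measurable.
Qed.

Definition closed_cell (q k : int) : set R := [set x | C (N%:R ^ q * x - k%:~R)].

Lemma closed_cell_measurable q k : measurable (closed_cell q k : set (measurableTypeR R)).
Proof.
by rewrite -[X in measurable X]setTI; exact: affine_measurable fractal_measurable.
Qed.

Lemma closed_cell_countable q k : countable (closed_cell q k `\` cell q k).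
Proof.
pose f y : R := N%:R ^ (- q) * (y + k%:~R).
apply: (@sub_countable _ _ _ (f @` (C `\` core))); last first.
  exact: sub_countable (card_image_le f _) fractal_core_countable.
apply: subset_card_le => x [Cx nx]; exists (N%:R ^ q * x - k%:~R) => //.
by rewrite /f subrK mulrA -expfzDr// addNr expr0z mul1r.
Qed.

Lemma inflated_fractalE : @inflated_fractal R N a =
  \bigcup_(v : int * int) closed_cell v.1 v.2.
Proof.
apply/seteqP; split=> [x [q _ [k _ [y Cy <-]]]|x [[q k] _ Cx]].
  exists (q, k) => //=; rewrite /closed_cell/= mulrA -expfzDr// subrr expr0z mul1r.
  by rewrite addrK.
exists q => //; exists k => //; exists (N%:R ^ q * x - k%:~R) => //.
by rewrite subrK mulrA -expfzDr// addNr expr0z mul1r.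
Qed.

Lemma inflated_fractal_measurable :
  measurable (@inflated_fractal R N a : set (measurableTypeR R)).
Proof.
rewrite inflated_fractalE; apply: countable_bigcupT_measurable => // v.
exact: closed_cell_measurable.
Qed.

Lemma inflated_fractal_countable :
  countable (@inflated_fractal R N a `\` \bigcup_(v : int * int) cell v.1 v.2).
Proof.
apply: (@sub_countable _ _ _
  (\bigcup_(v : int * int) (closed_cell v.1 v.2 `\` cell v.1 v.2))).
  apply: subset_card_le => x []; rewrite inflated_fractalE => -[v _ Cx] nx.
  by exists v => //; split=> // cx; apply: nx; exists v.
by apply: bigcup_countable => // v _; exact: closed_cell_countable.
Qed.

Lemma cell_inflated q k : cell q k `<=` @inflated_fractal R N a.
Proof.
by move=> x cx; rewrite inflated_fractalE; exists (q, k) => //; exact: core_fractal.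
Qed.

End expansion.

(** * Hausdorff measure: translations, countable sets, an upper bound *)

Section hausdorff.
Context {R : realType}.
Implicit Types (A F : set R) (s t : R).

Lemma ediam_translate F t : ediam [set x | F (x + t)] = ediam F.
Proof.
rewrite /ediam; congr ereal_sup; apply/seteqP; split=> _ [[x y] [Fx Fy] <-].
  by exists (x + t, y + t); rewrite //= opprD addrACA subrr addr0.
exists (x - t, y - t); first by split; rewrite /= subrK.
by rewrite /= opprB addrA subrK.
Qed.

Lemma hausdorff_content_translate_le s delta A t :
  (hausdorff_content s delta [set x | A (x + t)%R] <= hausdorff_content s delta A)%E.
Proof.
apply: le_ereal_inf_tmp => _ [F [AF dF] <-].
apply: ereal_inf_lbound; exists (fun j => [set x | F j (x + t)]).
  split=> [x /AF[j _ Fx]|j]; first by exists j.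
  by rewrite ediam_translate.
apply: eq_eseriesr => j _; rewrite /hausdorff_gauge ediam_translate.
rewrite (_ : ([set x | F j (x + t)] == set0) = (F j == set0))//.
apply/eqP/eqP => [F0|->//]; rewrite -subset0 => x Fx.
by have : [set x | F j (x + t)] (x - t); [rewrite /= subrK|rewrite F0].
Qed.

Lemma hausdorff_measure_translate s A t :
  hausdorff_measure s [set x | A (x + t)] = hausdorff_measure s A.
Proof.
suff le B u : (hausdorff_measure s [set x | B (x + u)%R] <= hausdorff_measure s B)%E.
  apply/eqP; rewrite eq_le le/=.
  have := le [set x | A (x + t)] (- t).
  rewrite (_ : [set x | _ (x - t)] = A)//.
  by apply/seteqP; split=> x /=; rewrite subrK.
apply: ge_ereal_sup => _ [delta d0 <-].
exact: le_trans (hausdorff_content_translate_le _ _ _ _) (hausdorff_content_le_measure _ _ _).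
Qed.

Lemma hausdorff_measure_set1 s x : 0 < s -> hausdorff_measure s [set x] = 0%E.
Proof.
move=> s0; apply/eqP; rewrite eq_le hausdorff_measure_ge0 andbT.
have d0 : ediam [set x] = 0%E.
  rewrite -[RHS]ereal_sup1; congr ereal_sup.
  apply/seteqP; split=> [_ [[y z] [/= -> ->] <-]|_ ->]; first by rewrite subrr normr0.
  by exists (x, x) => //=; rewrite subrr normr0.
apply: ge_ereal_sup => _ [delta /= delta0 <-].
apply: ereal_inf_lbound; exists (fun=> [set x]).
  by split=> [y ->|j]; [exists 0%N|rewrite d0 lee_fin ltW].
rewrite eseries0// => j _ _; rewrite /hausdorff_gauge d0 poweR0r ?lt0r_neq0//.
exact: if_same.
Qed.

Lemma hausdorff_measure_countable s A : 0 < s -> countable A ->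
  hausdorff_measure s A = 0%E.
Proof.
move=> s0 cA.
move/countable_injP: cA => [f injf]; apply/eqP; rewrite eq_le hausdorff_measure_ge0 andbT.
pose F n := [set x | A x /\ f x = n].
apply: (@le_trans _ _ (hausdorff_measure s (\bigcup_n F n))).
  by apply: le_hausdorff_measure => x Ax; exists (f x).
apply: le_trans (hausdorff_measure_sigma_subadditive _ _) _.
rewrite eseries0// => n _ _; apply/eqP; rewrite eq_le hausdorff_measure_ge0 andbT.
have [->|/set0P[x [Ax fx]]] := eqVneq (F n) set0; first by rewrite hausdorff_measure0.
rewrite -(hausdorff_measure_set1 x s0); apply: le_hausdorff_measure => y [Ay fy].
by apply: injf; rewrite ?inE// fx fy.
Qed.

End hausdorff.

Section fractal_hausdorff.
Context {R : realType} (N p : nat) (a : p.-tuple nat).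
Hypothesis p2 : (2 <= p)%N.
Hypothesis N2 : (2 <= N)%N.
Hypothesis a_uniq : uniq a.
Hypothesis aN : {in a, forall d, (d < N)%N}.

Local Notation C := (@fractal R N a).
Local Notation s := (@fractal_dim R N a).

Let NR_gt1 : 1 < N%:R :> R. Proof. by rewrite ltr1n. Qed.
Let pR_gt1 : 1 < p%:R :> R. Proof. by rewrite ltr1n. Qed.
Let NR_gt0 : 0 < N%:R :> R. Proof. exact: lt_trans NR_gt1. Qed.
Let pR_gt0 : 0 < p%:R :> R. Proof. exact: lt_trans pR_gt1. Qed.

Lemma fractal_dim_gt0 : 0 < s.
Proof. by rewrite /fractal_dim size_tuple divr_gt0// ln_gt0. Qed.

(** The dimension is chosen such that N^s = p. *)
Lemma powR_fractal_dim n : ((N%:R ^+ n)^-1) `^ s = (p%:R ^+ n)^-1 :> R.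
Proof.
rewrite -!exprVn -powR_mulrn ?invr_ge0 ?ltW// -powRrM mulrC powRrM powR_mulrn ?powR_ge0//.
congr (_ ^+ _); rewrite /powR invr_eq0 gt_eqF// lnV ?posrE// mulrN /fractal_dim size_tuple.
by rewrite divfK ?gt_eqF ?ln_gt0// expRN lnK ?posrE.
Qed.

(** All the values of [prefix_value] on n digits from a. *)
Fixpoint words n : seq nat :=
  if n is m.+1 then [seq (N * w + e)%N | w <- words m, e <- a] else [:: 0%N].

Lemma size_words n : size (words n) = (p ^ n)%N.
Proof. by elim: n => [//|n IH] /=; rewrite size_allpairs IH size_tuple expnSr. Qed.

Lemma prefix_words d n : (forall j, d j \in a) -> prefix_value N d n \in words n.
Proof. by move=> da; elim: n => [//|n IH] /=; exact: allpairs_f. Qed.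

(** The p^n intervals of length N^(-n) attached to the words of length n cover
    the fractal, and p^n N^(-n s) = 1. *)
Lemma hausdorff_fractal_le1 : (hausdorff_measure s C <= 1)%E.
Proof.
apply: ge_ereal_sup => _ [delta /= delta0 <-].
have [n /ltW nd] := exp_inv_lt N2 delta0.
pose I w : set R := [set x | w%:R <= N%:R ^+ n * x <= w%:R + 1].
pose F j := if (j < size (words n))%N then I (nth 0%N (words n) j) else set0.
have NX_gt0 : 0 < N%:R ^+ n :> R by rewrite exprn_gt0.
have dI w : (ediam (I w) <= (N%:R ^+ n)^-1%:E)%E.
  apply: ge_ereal_sup => _ [[x y] [/= /andP[x1 x2] /andP[y1 y2]] <-].
  rewrite lee_fin -(ler_pM2l NX_gt0) divff ?gt_eqF//.
  by rewrite -[X in X * _](gtr0_norm NX_gt0) -normrM mulrBr ler_norml; apply/andP; split; lra.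
apply: (@le_trans _ _ (\sum_(j <oo) hausdorff_gauge s (F j))%E).
  apply: ereal_inf_lbound; exists F => //; split.
    move=> x /(fractalP N2 aN)[d da dx].
    have dw := prefix_words n da; exists (index (prefix_value N d n) (words n)) => //.
    by rewrite /F index_mem dw nth_index//; exact: dx.
  move=> j; rewrite /F; case: ifP => _; last by rewrite ediam0 leNye.
  by apply: le_trans (dI _) _; rewrite lee_fin.
have gF j : (hausdorff_gauge s (F j) <=
    (if (j < p ^ n)%N then (p%:R ^+ n)^-1 else 0)%:E)%E.
  rewrite /F size_words; case: ifP => _; last by rewrite hausdorff_gauge0.
  rewrite -powR_fractal_dim /hausdorff_gauge; case: ifP => [_|/negbT/set0P[x Ix]].
    by rewrite lee_fin powR_ge0.
  have d0 : (0 <= ediam (I (nth 0%N (words n) j)))%E.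
    by apply: le_trans (ge_ediam Ix Ix); rewrite subrr normr0.
  rewrite -poweR_EFin; apply: gt0_ler_poweR => //.
  - by rewrite ltW// fractal_dim_gt0.
  - by rewrite in_itv/= d0 leey.
  - by rewrite in_itv/= leey lee_fin invr_ge0 ltW.
apply: lime_le; first by apply: is_cvg_nneseries => *; exact: hausdorff_gauge_ge0.
apply: nearW => k; apply: (@le_trans _ _ ((minn k (p ^ n))%:R / p%:R ^+ n)%:E).
  elim: k => [|k IH]; first by rewrite big_geq// min0n mul0r.
  rewrite big_nat_recr//=; apply: le_trans (leeD IH (gF k)) _.
  rewrite -EFinD lee_fin; case: ltnP => kp.
    by rewrite (minn_idPl kp) -[X in _ + X]mul1r -mulrDl natr1.
  by rewrite addr0 (minn_idPr (leqW kp)).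
by rewrite lee_fin ler_pdivrMr ?exprn_gt0// mul1r -natrX ler_nat geq_minr.
Qed.

End fractal_hausdorff.

(** * A lower bound for the Hausdorff measure by mass distribution *)

Lemma window5 (u v : nat) : (u <= v + 2)%N -> (v <= u + 2)%N ->
  (u + 2 - v < 5)%N /\ u = (v + (u + 2 - v)).-2.
Proof. by move=> *; split; lia. Qed.

Section mass_distribution.
Context {R : realType} (N p : nat) (a : p.-tuple nat).
Hypothesis p2 : (2 <= p)%N.
Hypothesis N2 : (2 <= N)%N.
Hypothesis a_uniq : uniq a.
Hypothesis aN : {in a, forall d, (d < N)%N}.
Implicit Types (F : set R) (x y : R).

Local Notation C := (@fractal R N a).
Local Notation s := (@fractal_dim R N a).
Local Notation lambda := (@lebesgue_measure R).

Let NR_gt1 : 1 < N%:R :> R. Proof. by rewrite ltr1n. Qed.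
Let pR_gt1 : 1 < p%:R :> R. Proof. by rewrite ltr1n. Qed.
Let NR_gt0 : 0 < N%:R :> R. Proof. exact: lt_trans NR_gt1. Qed.
Let pR_gt0 : 0 < p%:R :> R. Proof. exact: lt_trans pR_gt1. Qed.
Let NX_gt0 n : 0 < N%:R ^+ n :> R. Proof. exact: exprn_gt0. Qed.
Let pX_gt0 n : 0 < p%:R ^+ n :> R. Proof. exact: exprn_gt0. Qed.

(** The coefficient of p^(-j-1) in the base-p expansion of y. *)
Definition base_digit y j : nat := absz (level p j.+1 y - p%:Z * level p j y)%R.

Lemma base_digitP y j :
  (base_digit y j < p)%N /\ level p j.+1 y = p%:Z * level p j y + base_digit y j.
Proof.
have h1 : p%:Z * level p j y <= level p j.+1 y.
  rewrite /level floor_ge_int exprS -mulrA intrM.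
  by rewrite ler_pM2l// floor_le.
have h2 : level p j.+1 y < p%:Z * level p j y + p%:Z.
  rewrite /level floor_lt_int exprS -mulrA -[X in _ + X]mulr1 -mulrDr intrM.
  by rewrite ltr_pM2l// floorD1_gt.
by rewrite /base_digit; split; lia.
Qed.

(** The base-N number obtained by reading the first n base-p digits of y as
    positions in the list a. *)
Definition code y n := prefix_value N (fun j => nth 0%N a (base_digit y j)) n.

Lemma code_digit y j : nth 0%N a (base_digit y j) \in a.
Proof. by rewrite mem_nth// size_tuple; have [] := base_digitP y j. Qed.

(** A code determines its base-N digits, which determine the base-p digits
    because a has no repetition. *)
Lemma code_inj y y' n : level p 0 y = level p 0 y' -> code y n = code y' n ->
  level p n y = level p n y'.
Proof.
move=> yy'; elim: n => [//|n IH]; rewrite /code/= -!/(code _ n) => h.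
have [py ->] := base_digitP y n; have [py' ->] := base_digitP y' n.
have := aN (code_digit y n); have := aN (code_digit y' n).
move=> e1 e2.
have cc : code y n = code y' n.
  have N0 : (0 < N)%N by exact: ltn_trans N2.
  have := congr1 (fun v => v %/ N)%N h.
  by rewrite ![(N * _)%N]mulnC !divnMDl// !divn_small// !addn0.
move: h; rewrite cc => /addnI dd.
rewrite IH//; move/eqP: dd; rewrite nth_uniq ?size_tuple// => /eqP ->.
by [].
Qed.

Lemma lebesgue_level n m : lambda [set y : R | level p n y = m] = (p%:R ^+ n)^-1%:E.
Proof.
rewrite (level_itv p2) lebesgue_measure_itv/= lte_fin ltr_pM2r ?invr_gt0// ltr_int ltrDl ltr01.
by rewrite -EFinD -mulrBl -intrB addrAC subrr add0r mul1r.
Qed.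

Lemma cover_code c k : exists G : set (measurableTypeR R), [/\ measurable G,
  (lambda G <= (p%:R ^+ k)^-1%:E)%E &
  forall y, 0 <= y < 1 -> code y k = c -> G y].
Proof.
have l0 y : 0 <= y < 1 -> level p 0 y = 0.
  by move=> y01; apply/eqP; rewrite /level expr0 mul1r floor_eq.
have [[y0 [y01 <-]]|no] := pselect (exists y, 0 <= y < 1 /\ code y k = c).
  exists [set y : R | level p k y = level p k y0]; split.
  - exact: level_measurable.
  - by rewrite lebesgue_level.
  - by move=> y y1 /code_inj; apply; rewrite !l0.
exists set0; split=> //; first by rewrite measure0 lee_fin invr_ge0 ltW.
by move=> y y1 yc; apply: no; exists y.
Qed.

(** The preimage of F under the map that sends y in [0, 1) to the point of the
    fractal whose base-N digits are read off the base-p digits of y. *)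
Definition decoded F := [set y : R | 0 <= y < 1 /\
  exists2 x, F x & forall n, (code y n)%:R <= N%:R ^+ n * x <= (code y n)%:R + 1].

(** Two points of F are at distance at most N^(-k), so their codes of length k
    differ by at most 2. This leaves five possible codes, and each code is
    realized inside a single p-adic interval of length p^(-k). *)
Lemma cover_decoded k F : (ediam F <= (N%:R ^+ k)^-1%:E)%E ->
  exists B : set (measurableTypeR R), [/\ measurable B, decoded F `<=` B &
    (lambda B <= (5 / p%:R ^+ k)%:E)%E].
Proof.
move=> dF; have [->|/set0P[y0 [_ [x0 Fx0 /(_ k) x0P]]]] := eqVneq (decoded F) set0.
  by exists set0; split; rewrite // measure0 lee_fin divr_ge0// ltW.
(* i < 5 enumerates the codes from code y0 k - 2 to code y0 k + 2. *)
have /choice[G GP] := fun i => cover_code (code y0 k + i).-2 k.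
exists (\big[setU/set0]_(i < 5) G i); split.
- by apply: bigsetU_measurable => i _; have [] := GP i.
- move=> y [y01 [x Fx /(_ k) xP]].
  have : `|x0 - x| <= (N%:R ^+ k)^-1 by rewrite -lee_fin (le_trans (ge_ediam Fx0 Fx)).
  rewrite -(ler_pM2l (NX_gt0 k)) divff ?gt_eqF//.
  rewrite -[X in X * _](gtr0_norm (NX_gt0 k)) -normrM mulrBr ler_norml => /andP[d1 d2].
  have c1 : (code y k <= code y0 k + 2)%N.
    by rewrite -(ler_nat R) natrD; move: x0P xP => /andP[? ?] /andP[? ?]; lra.
  have c2 : (code y0 k <= code y k + 2)%N.
    by rewrite -(ler_nat R) natrD; move: x0P xP => /andP[? ?] /andP[? ?]; lra.
  have [i5 ci] := window5 c1 c2.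
  rewrite -bigcup_mkord; exists (code y k + 2 - code y0 k)%N => //.
  by have [_ _] := GP (code y k + 2 - code y0 k)%N; apply.
- apply: (@le_trans _ _ (\sum_(i < 5) lambda (G i))%E).
    apply: content_subadditive => // [i _|]; first by have [] := GP i.
    by apply: bigsetU_measurable => i _; have [] := GP i.
  apply: (@le_trans _ _ (\sum_(i < 5) (p%:R ^+ k)^-1%:E)%E).
    by apply: lee_sum => i _; have [] := GP i.
  by rewrite sumEFin sumr_const card_ord mulr_natl.
Qed.

(** For diam F = r in (0, 1], take k with N^(-k-1) < r <= N^(-k): then
    p^(-k) <= p r^s. If r = 0, the preimage is contained in sets of measure at
    most 5 p^(-k) for all k. *)
Lemma cover_decoded_gauge F : (ediam F <= 1)%E ->
  exists B : set (measurableTypeR R), [/\ measurable B, decoded F `<=` B &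
    (lambda B <= (5 * p%:R)%:E * hausdorff_gauge s F)%E].
Proof.
have c0 : 0 <= 5 * p%:R :> R by rewrite mulr_ge0 ?ltW.
rewrite /hausdorff_gauge => dF; have [->|F0] := eqVneq F set0.
  exists set0; split => //; last by rewrite measure0 mule0.
  by move=> y [_ [x []]].
have [x Fx] : exists x, F x by exact/set0P.
have : (0 <= ediam F)%E by apply: le_trans (ge_ediam Fx Fx); rewrite subrr normr0.
case dE : (ediam F) dF => [r| |]//; rewrite !lee_fin => r1 r0.
rewrite poweR_EFin -EFinM.
have [r00|rn0] := eqVneq r 0.
  have /choice[B BP] : forall k, exists B : set (measurableTypeR R),
      [/\ measurable B, decoded F `<=` B & (lambda B <= (5 / p%:R ^+ k)%:E)%E].
    by move=> k; apply: cover_decoded; rewrite dE r00 lee_fin invr_ge0 ltW.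
  exists (\bigcap_k B k); split.
  - by apply: bigcapT_measurable => k; have [] := BP k.
  - by move=> y Fy k _; have [_ + _] := BP k; exact.
  rewrite r00 powR0 ?gt_eqF ?(fractal_dim_gt0 a p2 N2)// mulr0.
  have cv : (5 / p%:R ^+ k) @[k --> \oo] --> (0 : R).
    rewrite -[X in _ --> X](mulr0 5); apply: cvgMr.
    under eq_fun do rewrite -exprVn.
    by apply: cvg_expr; rewrite normfV ger0_norm ?(ltW pR_gt0)// invf_lt1.
  have cvE : (5 / p%:R ^+ k)%:E @[k --> \oo] --> (0%:E : \bar R).
    by apply: cvg_EFin; [apply: nearW => k|exact: cv].
  apply: (cvge_ge _ cvE).
  apply: nearW => k; have [mBk _] := BP k; apply: le_trans.
  apply: le_measure; rewrite ?inE//; last exact: bigcap_inf.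
  by apply: bigcapT_measurable => j; have [] := BP j.
have r_gt0 : 0 < r by rewrite lt_neqAle eq_sym rn0.
have ex_small : exists k, (N%:R ^+ k.+1)^-1 < r.
  have [k kr] := exp_inv_lt N2 r_gt0; exists k; apply: le_lt_trans kr.
  by rewrite lef_pV2 ?posrE// ler_eXn2l.
case: (ex_minnP ex_small) => k kr kmin.
have rk : r <= (N%:R ^+ k)^-1.
  case: k {kr} kmin => [_|k kmin]; first by rewrite expr0 invr1.
  by rewrite leNgt; apply/negP => /kmin; rewrite ltnn.
have [|B [mB FB Bk]] := @cover_decoded k F; first by rewrite dE lee_fin.
exists B; split=> //; apply: le_trans Bk _; rewrite lee_fin.
have : (p%:R ^+ k.+1)^-1 <= r `^ s.
  rewrite -(powR_fractal_dim a p2 N2); apply: ge0_ler_powR.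
  - by rewrite ltW// fractal_dim_gt0.
  - by rewrite nnegrE invr_ge0 ltW.
  - by rewrite nnegrE.
  - exact: ltW.
rewrite -(ler_pM2l (_ : 0 < 5 * p%:R)) ?mulr_gt0//; apply: le_trans.
by rewrite exprS invfM mulrA mulfK ?gt_eqF.
Qed.

(** A cover of C by sets F j pulls back to a cover of [0, 1), whence
    1 <= 5 p (sum of the diam (F j)^s). *)
Lemma hausdorff_fractal_gt0 : (0 < hausdorff_measure s C)%E.
Proof.
have c0 : 0 < 5 * p%:R :> R by rewrite mulr_gt0.
suff : ((5 * p%:R)^-1%:E <= hausdorff_content s 1 C)%E.
  move=> h; apply: lt_le_trans (hausdorff_content_le_measure _ _ ltr01).
  by apply: lt_le_trans h; rewrite lte_fin invr_gt0.
apply: le_ereal_inf_tmp => _ [F [CF dF] <-].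
have /choice[B BP] : forall j, exists B : set (measurableTypeR R), [/\ measurable B,
    decoded (F j) `<=` B & (lambda B <= (5 * p%:R)%:E * hausdorff_gauge s (F j))%E].
  by move=> j; exact: cover_decoded_gauge.
have cov : `[0, 1[%classic `<=` \bigcup_j B j.
  move=> y /=; rewrite in_itv/= => y01.
  have [x [xc xP]] := @expansion_ex R _ _ N2 aN _ (code_digit y).
  have [j _ Fx] := CF x ((fractalP N2 aN x).2 (ex_intro2 _ _ _ (code_digit y) xP)).
  by have [_ sub _] := BP j; exists j => //; apply: sub; split=> //; exists x.
rewrite -(@lee_pmul2l _ (5 * p%:R)%:E)//.
rewrite -EFinM divff ?gt_eqF//.
rewrite -nneseriesZl; last by move=> j _; exact: hausdorff_gauge_ge0.
have <- : lambda `[0, 1[%classic = 1%:E.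
  by rewrite lebesgue_measure_itv/= lte_fin ltr01 sube0.
have mB j : measurable (B j) by have [] := BP j.
have mI : measurable (`[0, 1[%classic : set (measurableTypeR R)) by exact: measurable_itv.
apply: le_trans (@measure_sigma_subadditive _ _ _ lambda _ B mB mI cov) _.
by apply: lee_nneseries => [j _ _|j _]; [exact: measure_ge0|have [] := BP j].
Qed.

End mass_distribution.

(** * The normalized measure of a cell *)

Section normalized_measure.
Context {R : realType} (N p : nat) (a : p.-tuple nat).
Hypothesis p2 : (2 <= p)%N.
Hypothesis N2 : (2 <= N)%N.
Hypothesis a_uniq : uniq a.
Hypothesis aN : {in a, forall d, (d < N)%N}.

Local Notation C := (@fractal R N a).
Local Notation s := (@fractal_dim R N a).
Local Notation mu := (@fractal_measure R N a).
Local Notation cell := (@cell R N a).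
Local Notation h := (fine (hausdorff_measure s C)).

Let NR_neq0 : N%:R != 0 :> R. Proof. by rewrite pnatr_eq0 -lt0n (ltn_trans _ N2). Qed.
Let pR_neq0 : p%:R != 0 :> R. Proof. by rewrite pnatr_eq0 -lt0n (ltn_trans _ p2). Qed.

Lemma fractal_measureE A : mu A = (h^-1%:E * hausdorff_measure s A)%E.
Proof. by []. Qed.

Lemma fractal_measure_countable A : countable A -> mu A = 0%E.
Proof.
move=> cA; rewrite fractal_measureE (@hausdorff_measure_countable _ s A) ?mule0//.
exact: fractal_dim_gt0.
Qed.

Lemma fractal_measure_translate A t : mu [set x | A (x + t)] = mu A.
Proof. by rewrite !fractal_measureE hausdorff_measure_translate. Qed.

(** The core carries the whole mass of the fractal, which is finite and
    positive. *)
Lemma fractal_measure_core : mu (core N a) = 1%E.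
Proof.
rewrite fractal_measureE.
have -> : hausdorff_measure s (core N a) = hausdorff_measure s C.
  apply/eqP; rewrite eq_le; apply/andP; split.
    exact: le_hausdorff_measure (core_fractal N2 aN).
  rewrite -(@setDUK _ (core N a) C); last exact: core_fractal.
  apply: le_trans (outer_measureU2 _ _ _) _.
  rewrite [X in (_ + X)%E](hausdorff_measure_countable _ (fractal_core_countable N2 aN)).
    by rewrite adde0.
  exact: fractal_dim_gt0.
have := @hausdorff_fractal_gt0 R _ _ a p2 N2 a_uniq aN.
have := @hausdorff_fractal_le1 R _ _ a p2 N2 aN.
case: (hausdorff_measure s C) => [r| |]// _; rewrite lte_fin => r0.
by rewrite /= -EFinM mulVf ?gt_eqF.
Qed.

Lemma fractal_measure_cell_shift q k : mu (cell q k) = mu (cell q 0).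
Proof.
rewrite (_ : cell q k = [set x | cell q 0 (x - N%:R ^ (- q) * k%:~R)]).
  exact: fractal_measure_translate.
apply/seteqP; split=> x; rewrite /cell/= mulr0z subr0 mulrBr mulrA -expfzDr// subrr;
  by rewrite expr0z mul1r.
Qed.

(** A cell is the disjoint union of p translates of one cell of the next
    generation. *)
Lemma fractal_measure_cell_split q : mu (cell q 0) = (p%:R%:E * mu (cell (q + 1) 0))%E.
Proof.
pose U (t : seq nat) := [set x | exists2 e, e \in t & cell (q + 1) e x].
have mU t : measurable (U t : set (measurableTypeR R)).
  rewrite (_ : U t = \bigcup_(e in [set` t]) cell (q + 1) e).
    by apply: bigcup_measurable => e _; exact: cell_measurable.
  by apply/seteqP; split=> x [e et ex]; exists e.
have -> : cell q 0 = U a.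
  apply/seteqP; split=> x; rewrite cell_split// => -[e ea ex]; exists e => //;
    by move: ex; rewrite mulr0 add0r.
suff H (t : seq nat) : uniq t ->
    mu (U t) = ((size t)%:R%:E * mu (cell (q + 1) 0))%E.
  by rewrite H// size_tuple.
elim: t => [_|e t IH /= /andP[et ut]].
  rewrite mul0e (_ : U [::] = set0) ?measure0//.
  by apply/seteqP; split=> x [].
rewrite (_ : U (e :: t) = cell (q + 1) e `|` U t); last first.
  apply/seteqP; split=> [x [f]|x [xe|[f ft xf]]].
  - by rewrite inE => /orP[/eqP -> xe|ft xf]; [left|right; exists f].
  - by exists e => //; rewrite mem_head.
  - by exists f => //; rewrite inE ft orbT.
have m1 : measurable (cell (q + 1) e : set (measurableTypeR R)) by exact: cell_measurable.
have -> : mu (cell (q + 1) e `|` U t) = (mu (cell (q + 1) e) + mu (U t))%E.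
  apply: measureU => //; apply/seteqP; split=> [x [xe [f ft xf]]|//].
  move: (cell_floor xe); rewrite (cell_floor xf) => -[fe].
  by move: et; rewrite -fe ft.
by rewrite IH// fractal_measure_cell_shift -natr1 EFinD ge0_muleDl// mul1e addeC.
Qed.

Lemma fractal_measure_cell q k : mu (cell q k) = (p%:R ^ (- q))%:E.
Proof.
rewrite fractal_measure_cell_shift.
have cell00 : mu (cell 0 0) = 1%E.
  rewrite -fractal_measure_core (_ : cell 0 0 = core N a)//; apply/seteqP.
  by split=> x; rewrite /cell/= expr0z mul1r mulr0z subr0.
case: q => n.
- elim: n => [|n IH]; first by rewrite cell00 oppr0 expr0z.
  move: IH; rewrite fractal_measure_cell_split -addn1 PoszD.
  rewrite opprD expfzDr// EFinM => <-; rewrite muleAC -EFinM.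
  by rewrite exprN1 divff// mul1e.
- elim: n => [|n IH].
    by rewrite fractal_measure_cell_split NegzE addNr cell00 mule1 opprK expr1z.
  rewrite fractal_measure_cell_split (_ : Negz n.+1 + 1 = Negz n); last by lia.
  by rewrite IH -EFinM -{1}(expr1z p%:R) -expfzDr//; congr (_ ^ _)%:E; lia.
Qed.

End normalized_measure.

(** * Unitarity of the matrix of filters *)

(** The rows of the matrix of filters that are not unit vectors are row 0 and
    the rows i > N - p; the difference i - (N - p) numbers them from 0 to
    p - 1. *)
Lemma high_index_lt i N p : (0 < p <= N)%N -> (i < N)%N -> (i - (N - p) < p)%N.
Proof. by move=> *; lia. Qed.

Lemma high_index_inj i j m : ~~ (0 < i <= m)%N -> ~~ (0 < j <= m)%N ->
  (i == j) = (i - m == j - m)%N.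
Proof. by move=> *; apply/eqP/eqP; lia. Qed.

Lemma conj_realC (R : realType) (r : R) : (r%:C^*)%R = r%:C.
Proof. exact: conjc_real. Qed.

Section filters.
Context {R : realType} (N p : nat) (a : p.-tuple nat) (b : (N - p).-tuple nat).
Hypothesis p2 : (2 <= p)%N.
Hypothesis pN : (p <= N)%N.
Hypothesis a_uniq : uniq a.
Hypothesis aN : {in a, forall d, (d < N)%N}.
Hypothesis b_compl : perm_eq b [seq d <- iota 0 N | d \notin a].

Local Notation eta := (@Defs.eta R p).
Let theta : R := 2 * pi / p%:R.

Let pR_gt0 : 0 < p%:R :> R. Proof. by rewrite ltr0n (ltn_trans _ p2). Qed.
Let p_gt0 : (0 < p)%N. Proof. by rewrite (ltn_trans _ p2). Qed.

Lemma eta_exp n : eta ^+ n = cos (n%:R * theta) +i* sin (n%:R * theta).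
Proof.
elim: n => [|n IH]; first by rewrite expr0 mul0r cos0 sin0.
rewrite exprS IH -natr1 mulrDl mul1r cosD sinD /Defs.eta -/theta.
by rewrite -[LHS]/((_ - _) +i* (_ + _)); congr (_ +i* _); ring.
Qed.

(** If eta had order m < p, then cos (2 y) = 1 for y = m pi / p in (0, pi),
    although sin y > 0. *)
Lemma eta_prim : p.-primitive_root eta.
Proof.
have eta_p : eta ^+ p = 1.
  rewrite eta_exp /theta mulrC divfK ?gt_eqF// mulr_natl.
  by rewrite cos2pi sin2pi.
have [m m_prim mp] := prim_order_exists p_gt0 eta_p.
have m0 := prim_order_gt0 m_prim.
have := dvdn_leq p_gt0 mp; rewrite leq_eqVlt => /orP[/eqP mE|m_lt].
  by move: m_prim; rewrite [X in X.-primitive_root _]mE.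
have := prim_expr_order m_prim; rewrite eta_exp => -[+ _].
pose y : R := m%:R * pi / p%:R.
rewrite (_ : _ * theta = y + y); last by rewrite /y /theta; ring.
have : 0 < sin y.
  apply: sin_gt0_pi; rewrite /y divr_gt0 ?mulr_gt0 ?pi_gt0 ?ltr0n//=.
  by rewrite ltr_pdivrMr// [X in X < _]mulrC ltr_pM2l ?pi_gt0// ltr_nat.
have := cos2Dsin2 y; rewrite cosD.
by move: (cos y) (sin y) => u v; nra.
Qed.

Lemma eta_conj : eta * eta^* = 1.
Proof.
rewrite /Defs.eta -/theta -[LHS]/((_ - _) +i* (_ + _)).
by congr (_ +i* _); [rewrite -(cos2Dsin2 theta)|]; ring.
Qed.

(** A geometric sum of powers of w = eta^(j - j'). *)
Lemma eta_orthogonality j j' : (j < p)%N -> (j' < p)%N ->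
  \sum_(k < p) eta ^+ (k * j) * (eta ^+ (k * j'))^* = (p * (j == j'))%:R.
Proof.
move=> jp j'p; pose w := eta ^+ j * (eta^*) ^+ j'.
have eta0 : eta != 0.
  by apply/eqP => e0; have := eta_conj; rewrite e0 mul0r => /esym/eqP; rewrite oner_eq0.
under eq_bigr => k _ do rewrite rmorphXn/= !(mulnC k) !exprM -exprMn -/w.
have etaJ : (eta^*)%R = eta^-1 by apply: (mulfI eta0); rewrite eta_conj divff.
have [jj|jj] := eqVneq j j'.
  have w1 : w = 1 by rewrite /w jj etaJ exprVn divff// expf_neq0.
  by under eq_bigr do rewrite w1 expr1n; rewrite sumr_const card_ord muln1.
have w1 : w != 1.
  rewrite /w etaJ exprVn; apply: contraNneq jj => h.
  have := eq_prim_root_expr eta_prim j j'; rewrite !modn_small// => <-.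
  by rewrite -[X in X == _](divfK (expf_neq0 j' eta0)) h mul1r.
rewrite muln0; have wp : w ^+ p = 1.
  rewrite /w etaJ exprMn -!exprM mulnC [(j' * p)%N]mulnC !exprM.
  by rewrite exprVn (prim_expr_order eta_prim) invr1 !expr1n mulr1.
have := subrX1 w p; rewrite wp subrr => /esym/eqP.
by rewrite mulf_eq0 subr_eq0 (negPf w1) => /eqP.
Qed.

Lemma perm_digits : perm_eq (a ++ b) (iota 0 N).
Proof.
apply: uniq_perm; last first.
- move=> d; rewrite mem_cat (perm_mem b_compl) mem_filter mem_iota/= add0n.
  by have [/aN ->|] := boolP (d \in a).
- exact: iota_uniq.
- rewrite cat_uniq a_uniq (perm_uniq b_compl) filter_uniq ?iota_uniq// andbT/=.
  by apply/hasPn => d; rewrite (perm_mem b_compl) mem_filter => /andP[].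
Qed.

Lemma b_uniq : uniq b.
Proof. by rewrite (perm_uniq b_compl) filter_uniq ?iota_uniq. Qed.

Lemma big_digits (F : nat -> R[i]) : \sum_(d < N) F d =
  \sum_(j < p) F (nth 0%N a j) + \sum_(j < N - p) F (nth 0%N b j).
Proof.
rewrite -(big_mkord xpredT) /index_iota subn0 -(perm_big _ perm_digits) big_cat/=.
rewrite [X in X + _](big_nth 0%N) [X in _ + X](big_nth 0%N).
by rewrite !big_mkord !size_tuple.
Qed.

(** The coefficient of z^d in m_i. For i = 0 the truncated difference
    i - (N - p) is 0, so the second branch gives the low-pass filter
    p^(-1/2) (z^a_1 + ... + z^a_p). *)
Definition filt (i d : nat) : R[i] :=
  if (0 < i <= N - p)%N then (d == nth 0%N b i.-1)%:R else
  (Num.sqrt p%:R)^-1%:C *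
    \sum_(j < p) eta ^+ ((i - (N - p)) * j) * (d == nth 0%N a j)%:R.

Lemma wavelet_filter_coef i d : (0 < i)%N -> (wavelet_filter N p a b i)`_d = filt i d.
Proof.
move=> i0; rewrite /wavelet_filter /filt i0/=; case: ifP => _; first by rewrite coefXn.
rewrite coefZ; congr (_ * _); rewrite coef_sum big_add1/= big_mkord.
by apply: eq_bigr => j _; rewrite coefZ coefXn.
Qed.

Lemma filt_a i j : (j < p)%N -> filt i (nth 0%N a j) =
  if (0 < i <= N - p)%N then 0 else
  (Num.sqrt p%:R)^-1%:C * eta ^+ ((i - (N - p)) * j).
Proof.
move=> jp; rewrite /filt; case: ifP => [/andP[i0 iNp]|_].
  have : nth 0%N a j \in a by rewrite mem_nth// size_tuple.
  apply: contraTeq => h; have : nth 0%N b i.-1 \in b.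
    by rewrite mem_nth// size_tuple prednK.
  rewrite (perm_mem b_compl) mem_filter => /andP[+ _].
  by move: h; case: (nth 0%N a j =P nth 0%N b i.-1) => [<-//|]; rewrite eqxx.
congr (_ * _); rewrite (bigD1 (Ordinal jp))//= eqxx mulr1 big1 ?addr0// => k kj.
rewrite -val_eqE/= eq_sym in kj.
by rewrite nth_uniq ?size_tuple// (negPf kj) mulr0.
Qed.

Lemma filt0_a j : (j < p)%N -> filt 0 (nth 0%N a j) = (Num.sqrt p%:R)^-1%:C.
Proof. by move=> jp; rewrite filt_a// sub0n mul0n expr0 mulr1. Qed.

Lemma filt_b i j : (j < N - p)%N -> filt i (nth 0%N b j) =
  ((0 < i <= N - p) && (j == i.-1))%N%:R.
Proof.
move=> jp; rewrite /filt; case: ifP => [/andP[i0 iNp]|_].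
  by rewrite nth_uniq ?size_tuple ?b_uniq// prednK.
rewrite big1 ?mulr0// => k _; case: eqP => [h|]; last by rewrite mulr0.
have : nth 0%N b j \in b by rewrite mem_nth// size_tuple.
by rewrite (perm_mem b_compl) mem_filter h mem_nth ?size_tuple.
Qed.

Lemma filt_rows i i' : (i < N)%N -> (i' < N)%N ->
  \sum_(d < N) filt i d * (filt i' d)^* = (i == i')%:R.
Proof.
move=> iN i'N; rewrite (big_digits (fun d => filt i d * (filt i' d)^*)).
under eq_bigr => j _ do rewrite !filt_a//.
under [X in _ + X]eq_bigr => j _ do rewrite !filt_b// conjC_nat -natrM mulnb.
have [bi|ai] := boolP (0 < i <= N - p)%N; have [bi'|ai'] := boolP (0 < i' <= N - p)%N.
- rewrite big1 ?add0r => [|j _]; last by rewrite mul0r.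
  have [i0 i1] := andP bi; have [i'0 i'1] := andP bi'.
  have iP : (i.-1 < N - p)%N by rewrite prednK.
  rewrite (bigD1 (Ordinal iP))//= eqxx big1 ?addr0 => [|j].
    by rewrite -[in RHS](prednK i0) -[in RHS](prednK i'0) eqSS.
  by rewrite -val_eqE/= => /negPf ->.
- rewrite big1 ?add0r => [|j _]; last by rewrite mul0r.
  rewrite big1 => [|j _]; last by rewrite andbF.
  by case: eqP => // ii; move: ai'; rewrite -ii bi.
- rewrite big1 ?add0r => [|j _]; last by rewrite rmorph0 mulr0.
  rewrite big1 => [|j _] //.
  by case: eqP => // ii; move: ai; rewrite ii bi'.
rewrite [X in _ + X]big1 ?addr0 => [|j _] //.
set k := (i - (N - p))%N; set k' := (i' - (N - p))%N.
have kp : (k < p)%N by apply: high_index_lt => //; rewrite p_gt0.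
have k'p : (k' < p)%N by apply: high_index_lt => //; rewrite p_gt0.
have -> : (i == i')%:R = p%:R^-1 * (p * (k == k'))%:R :> R[i].
  rewrite natrM mulrA mulVf ?mul1r ?pnatr_eq0 -?lt0n//.
  by rewrite (high_index_inj ai ai').
rewrite -(eta_orthogonality kp k'p) mulr_sumr; apply: eq_bigr => j _.
rewrite rmorphM/= conj_realC mulrACA ![(j * _)%N]mulnC; congr (_ * _).
rewrite -rmorphM/= -invfM -expr2 sqr_sqrtr ?ler0n// fmorphV.
by rewrite rmorph_nat.
Qed.

(** A one-sided inverse of a square matrix is two-sided. *)
Lemma filt_cols d d' : (d < N)%N -> (d' < N)%N ->
  \sum_(i < N) (filt i d)^* * filt i d' = (d == d')%:R.
Proof.
move=> dN d'N.
pose M : 'M[R[i]]_N := \matrix_(i, d) filt i d.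
pose M' : 'M[R[i]]_N := \matrix_(d, i) (filt i d)^*.
have : M *m M' = 1%:M.
  apply/matrixP => i i'; rewrite !mxE -val_eqE /= -filt_rows//.
  by apply: eq_bigr => e _; rewrite !mxE.
move=> /mulmx1C/matrixP/(_ (Ordinal dN) (Ordinal d'N)); rewrite !mxE => <-.
by apply: eq_bigr => i _; rewrite !mxE.
Qed.

End filters.

(** * Indicator functions *)

Section indicator_L2.
Context d (T : measurableType d) (R : realType).
Variables (mu : {measure set T -> \bar R}) (D : set T) (mD : measurable D).
Implicit Types (A B : set T).

Definition cindic A : T -> R[i] := fun x => (\1_A x : R)%:C.

Lemma cindic_cmeasurable A : measurable A -> cmeasurable D (cindic A).
Proof.
move=> mA; split; last exact: measurable_cst.
by apply: measurable_funTS; exact: measurable_indic.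
Qed.

Lemma energy_cindic A : measurable A -> energy mu D (cindic A) = mu (A `&` D).
Proof.
move=> mA; rewrite -integral_indic//; apply: eq_integral => x _.
by rewrite normc_sq/= expr0n addr0 indicE; case: (_ \in _); rewrite ?expr1n ?expr0n.
Qed.

Lemma cindic_L2 A : measurable A -> (mu (A `&` D) < +oo)%E -> L2 mu D (cindic A).
Proof.
by move=> mA fA; apply/L2P; split; [exact: cindic_cmeasurable|rewrite energy_cindic].
Qed.

Lemma L2dot_cindic A B : measurable A -> measurable B ->
  L2dot mu D (cindic A) (cindic B) = (fine (mu (A `&` B `&` D)))%:C.
Proof.
move=> mA mB; rewrite /L2dot /Rintegral; congr (fine _ +i* _).
  rewrite -integral_indic//; last exact: measurableI.
  by apply: eq_integral => x _; rewrite indicI conj_realC -rmorphM.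
under eq_integral do rewrite conj_realC -rmorphM/=.
by rewrite integral0.
Qed.

Lemma L2dot_sumr (I : Type) (s : seq I) (c : I -> R[i]) (F : I -> T -> R[i]) f :
  (forall i, L2 mu D (F i)) -> L2 mu D f ->
  L2dot mu D f (fun x => \sum_(i <- s) c i * F i x) =
  \sum_(i <- s) (c i)^* * L2dot mu D f (F i).
Proof.
move=> LF Lf; have LcF i : L2 mu D (fun x => c i * F i x) by exact: L2Z.
rewrite L2dotC//; last exact: L2_sum.
rewrite L2dot_suml// rmorph_sum; apply: eq_bigr => i _.
by rewrite (L2dotZl mD (c i) (LF i) Lf) rmorphM [in RHS](L2dotC mD (LF i) Lf).
Qed.

Lemma L2dot_sumlZ (I : Type) (s : seq I) (c : I -> R[i]) (F : I -> T -> R[i]) f :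
  (forall i, L2 mu D (F i)) -> L2 mu D f ->
  L2dot mu D (fun x => \sum_(i <- s) c i * F i x) f =
  \sum_(i <- s) c i * L2dot mu D (F i) f.
Proof.
move=> LF Lf; have LcF i : L2 mu D (fun x => c i * F i x) by exact: L2Z.
by rewrite L2dot_suml//; apply: eq_bigr => i _; exact: L2dotZl.
Qed.

Lemma L2dotZr (c : R[i]) f g : L2 mu D f -> L2 mu D g ->
  L2dot mu D f (fun x => c * g x) = c^* * L2dot mu D f g.
Proof.
move=> Lf Lg; rewrite L2dotC//; last exact: L2Z.
by rewrite L2dotZl// [in RHS](L2dotC mD Lg Lf); exact: (rmorphM (@Num.conj _)).
Qed.

End indicator_L2.

(** * Powers of the translation and dilation operators *)

Section wavelet_formula.
Context {R : realType} (N p : nat).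
Hypothesis N2 : (2 <= N)%N.
Hypothesis p2 : (2 <= p)%N.
Implicit Types f : R -> R[i].

Let NR_neq0 : N%:R != 0 :> R. Proof. by rewrite pnatr_eq0 -lt0n (ltn_trans _ N2). Qed.
Let sp_neq0 : Num.sqrt p%:R != 0 :> R.
Proof. by rewrite sqrtr_eq0 -ltNge ltr0n (ltn_trans _ p2). Qed.

Lemma TpowE (n : int) f x : Tpow n f x = f (x - n%:~R).
Proof.
case: n => n; rewrite /Tpow/op_power.
  elim: n x => [|n IH] x; first by rewrite subr0.
  by rewrite iterS /translation IH -addn1 PoszD intrD opprD addrA addrAC.
rewrite NegzE rmorphN opprK; elim: n x => [|n IH] x; first by rewrite iterS.
by rewrite iterS /translation_inv IH -addrA (addrC 1) natr1.
Qed.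

Lemma UpowE (m : int) f x :
  Upow N p m f x = (Num.sqrt p%:R ^ (- m))%:C * f (N%:R ^ (- m) * x).
Proof.
case: m => n; rewrite /Upow/op_power.
  elim: n x => [|n IH] x; first by rewrite oppr0 !expr0z mul1r mul1r.
  rewrite iterS /dilation IH -addn1 PoszD opprD !expfzDr// mulrA -rmorphM/=.
  by rewrite !exprN1 [_^-1 * _ ^ _]mulrC; congr (_ * f _); rewrite -mulrA [_ / _]mulrC.
rewrite NegzE opprK; elim: n x => [|n IH] x; first by rewrite iterS !expr1z.
rewrite iterS /dilation_inv IH -[in RHS]addn1 PoszD !expfzDr// !expr1z mulrA -rmorphM/=.
by rewrite [Num.sqrt _ * _]mulrC mulrA.
Qed.

End wavelet_formula.

(** * Localization to a set *)

Section localization.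
Context d (T : measurableType d) (R : realType).
Variables (mu : {measure set T -> \bar R}) (D : set T) (mD : measurable D).
Variables (I : eqType) (e : I -> T -> R[i]).
Hypothesis Le : forall i, L2 mu D (e i).
Implicit Types (f : T -> R[i]) (A : set T).

Definition localize f A : T -> R[i] := fun x => f x * cindic R A x.

Lemma cindicI A B x : cindic R (A `&` B) x = cindic R A x * cindic R B x.
Proof. by rewrite /cindic indicI rmorphM. Qed.

Lemma localize_cindic A B : localize (cindic R A) B = cindic R (A `&` B).
Proof. by apply/funext => x; rewrite cindicI. Qed.

Lemma localize_localize f A B : localize (localize f A) B = localize f (A `&` B).
Proof. by apply/funext => x; rewrite /localize cindicI mulrA. Qed.

Lemma localize_normc_le f A x : normc (localize f A x) ^+ 2 <= normc (f x) ^+ 2.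
Proof.
rewrite /localize /cindic indicE; case: (_ \in _); first by rewrite rmorph1 mulr1.
by rewrite rmorph0 mulr0 normc_sq/= expr0n addr0 sqr_ge0.
Qed.

Lemma localize_cmeasurable f A :
  measurable A -> cmeasurable D f -> cmeasurable D (localize f A).
Proof.
move=> mA [f1 f2]; have mI : measurable_fun D (\1_A : T -> R) by exact: measurable_indic.
split.
- rewrite (_ : (fun x => _) = (fun x => complex.Re (f x) * \1_A x)).
    exact: measurable_funM.
  by apply/funext => x; rewrite /localize/cindic; case: (f x) => u v /=; rewrite mulr0 subr0.
- rewrite (_ : (fun x => _) = (fun x => complex.Im (f x) * \1_A x)).
    exact: measurable_funM.
  by apply/funext => x; rewrite /localize/cindic; case: (f x) => u v /=; rewrite mulr0 add0r.
Qed.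

Lemma L2_le f g : L2 mu D f -> cmeasurable D g ->
  (forall x, D x -> normc (g x) ^+ 2 <= normc (f x) ^+ 2) -> L2 mu D g.
Proof.
move=> /L2P[mf fy] mg gf; apply/L2P; split=> //; apply: le_lt_trans fy.
apply: ge0_le_integral => //.
- by move=> x _; rewrite lee_fin sqr_ge0.
- exact: measurable_normc_sq.
- exact: measurable_normc_sq.
Qed.

Lemma localize_L2 f A : measurable A -> L2 mu D f -> L2 mu D (localize f A).
Proof.
move=> mA Lf; apply: (L2_le Lf).
  by apply: localize_cmeasurable => //; exact: L2_cmeasurable Lf.
by move=> x _; exact: localize_normc_le.
Qed.

Lemma sum_indic_trivIset (B : (set T)^nat) j n x : trivIset setT B -> B j x ->
  \sum_(i < n) cindic R (B i) x = (j < n)%N%:R.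
Proof.
move=> tB Bx; have ind i : cindic R (B i) x = (i == j)%:R.
  rewrite /cindic indicE; have [->|ij] := eqVneq i j; first by rewrite mem_set ?rmorph1.
  rewrite memNset ?rmorph0// => Bi; move/eqP: ij; apply; apply: tB => //.
  by exists x.
under eq_bigr do rewrite ind; have [jn|nj] := ltnP j n.
  rewrite (bigD1 (Ordinal jn))//= eqxx big1 ?addr0// => i.
  by rewrite -val_eqE/= => /negPf ->.
by rewrite big1// => i _; rewrite ltn_eqF// (leq_trans _ nj).
Qed.

(** The partial sums of the pieces of f agree with f on the first n sets and
    vanish elsewhere, so they are dominated by f. *)
Lemma approximable_localize_bigcup f (B : (set T)^nat) : L2 mu D f ->
  (forall j, measurable (B j)) -> trivIset setT B ->
  {ae mu, forall x, D x -> f x = 0 \/ (\bigcup_j B j) x} ->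
  (forall j, approximable mu D e (localize f (B j))) -> approximable mu D e f.
Proof.
move=> Lf mB tB cov aB; have mf := L2_cmeasurable Lf.
pose F n x := \sum_(i < n) localize f (B i) x.
have FE n x : F n x = f x * \sum_(i < n) cindic R (B i) x by rewrite mulr_sumr.
have sum01 n x : \sum_(i < n) cindic R (B i) x = 0 \/ \sum_(i < n) cindic R (B i) x = 1.
  have [[j Bx]|nB] := pselect (exists j, B j x).
    by rewrite (sum_indic_trivIset n tB Bx); case: ltnP; [right|left].
  left; rewrite big1// => i _; rewrite /cindic indicE memNset ?rmorph0// => Bi.
  by apply: nB; exists i.
have aF n : cmeasurable D (F n) /\ approximable mu D e (F n).
  split; first exact: L2_cmeasurable (L2_sum mD _ (fun i : 'I_n => localize_L2 (mB i) Lf)).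
  by apply: approximable_sum => // i; exact: localize_cmeasurable.
apply: (@approximable_dominated _ _ _ mu D mD _ e Le f F) => //.
- by move=> n; have [] := aF n.
- by move=> n; have [] := aF n.
- apply: filterS cov => x /[apply] -[f0|[j _ Bx]].
    apply: cvg_near_cst; apply: nearW => n.
    by rewrite FE f0 mul0r subrr normc_sq/= expr0n addr0.
  apply: cvg_near_cst; exists j.+1 => // n /= jn.
  by rewrite FE (sum_indic_trivIset n tB Bx) jn mulr1 subrr normc_sq/= expr0n addr0.
- move=> n x _; rewrite FE; have [->|->] := sum01 n x; last by rewrite mulr1.
  by rewrite mulr0 normc_sq/= expr0n addr0 sqr_ge0.
Qed.

Section simple_approximation.
Import HBNNSimple.
Variable A : set T.
Hypothesis mA : measurable A.
Hypothesis approx_indic : forall B, measurable B ->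
  approximable mu D e (cindic R (B `&` A)).

Lemma approximable_localize_simple (g : {nnsfun T >-> R}) :
  approximable mu D e (localize (fun x => (g x)%:C) A).
Proof.
pose s : seq R := finmap.enum_fset (fset_set (range g)).
have -> : localize (fun x => (g x)%:C) A =
    (fun x => \sum_(y <- s) y%:C * cindic R ((g @^-1` [set y]) `&` A) x).
  apply/funext => x; rewrite /localize fimfunE fsbig_finite//= rmorph_sum/= mulr_suml.
  apply: eq_bigr => y _; rewrite rmorphM/= -mulrA; congr (_ * _).
  by rewrite -cindicI.
have mI y : measurable (g @^-1` [set y] `&` A).
  by apply: measurableI => //; exact: measurable_funPTI.
apply: approximable_sum => // y.
  by apply: cmeasurableZ; exact: cindic_cmeasurable.
apply: approximableZ => //; first exact: cindic_cmeasurable.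
exact: approx_indic.
Qed.

Lemma approximable_localize_ge0 (g : T -> R) : L2 mu D (fun x => (g x)%:C) ->
  (forall x, 0 <= g x) -> approximable mu D e (localize (fun x => (g x)%:C) A).
Proof.
move=> Lg g0; have [[mg _] _] := (L2P _ _ _).1 Lg.
have mEg : measurable_fun D (EFin \o g) by exact/measurable_EFinP.
pose G n := nnsfun_approx mD mEg n.
have Eg0 x : D x -> (0 <= (EFin \o g) x)%E by rewrite lee_fin.
apply: (@approximable_dominated _ _ _ mu D mD _ e Le _
  (fun n => localize (fun x => (G n x)%:C) A)).
- exact: localize_L2.
- move=> n; apply: localize_cmeasurable => //; split; last exact: measurable_cst.
  exact: measurable_funTS.
- by move=> n; exact: approximable_localize_simple.
- apply: aeW => x Dx; have /fine_cvg /= Gg := cvg_nnsfun_approx mD mEg Eg0 Dx.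
  have E n : normc (localize (fun x => (g x)%:C) A x -
      localize (fun x => (G n x)%:C) A x) ^+ 2 =
      ((g x - G n x) * \1_A x) ^+ 2.
    by rewrite /localize /cindic -!rmorphM -rmorphB normc_sq/= expr0n addr0 -mulrBl.
  under eq_fun do rewrite E.
  have cv : (g x - G n x) * \1_A x @[n --> \oo] --> (g x - g x) * \1_A x.
    by apply: cvgMl; apply: cvgB => //; exact: cvg_cst.
  by have := cvgM cv cv; rewrite subrr !mul0r; exact.
- move=> n x Dx; apply: (@le_trans _ _ ((G n x * \1_A x) ^+ 2)).
    by rewrite /localize /cindic -!rmorphM normc_sq/= expr0n addr0.
  rewrite /localize /cindic -!rmorphM normc_sq/= expr0n addr0.
  have i0 : 0 <= \1_A x :> R by rewrite indicE.
  rewrite ler_sqr ?nnegrE ?mulr_ge0//; apply: ler_wpM2r => //.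
  rewrite -lee_fin /G nnsfun_approxE; exact: le_approx.
Qed.

Lemma approximable_localize_real (g : T -> R) : L2 mu D (fun x => (g x)%:C) ->
  approximable mu D e (localize (fun x => (g x)%:C) A).
Proof.
move=> Lg; have [[mg _] _] := (L2P _ _ _).1 Lg.
pose P (h : T -> R) x := Num.max (h x) 0.
have P0 h x : 0 <= P h x by rewrite le_max lexx orbT.
have mP h : measurable_fun D h -> measurable_fun D (P h).
  by move=> mh; exact: measurable_maxr.
have mN : measurable_fun D (fun x => - g x) by exact: measurable_funN.
have LP (h : T -> R) : measurable_fun D h -> (forall x, h x ^+ 2 = g x ^+ 2) ->
    L2 mu D (fun x => (P h x)%:C).
  move=> mh hg; apply: (L2_le Lg); first by split; [exact: mP|exact: measurable_cst].
  move=> x _; rewrite !normc_sq/= expr0n !addr0 -hg /P.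
  by case: (leP (h x) 0) => _; rewrite ?expr0n/= ?sqr_ge0 ?lexx.
have L1 := LP g mg (fun=> erefl).
have L2' := LP _ mN (fun x => sqrrN (g x)).
have -> : localize (fun x => (g x)%:C) A = (fun x => localize (fun x => (P g x)%:C) A x +
    (-1) * localize (fun x => (P (fun x => - g x) x)%:C) A x).
  apply/funext => x; rewrite /localize mulrA -mulrDl; congr (_ * _).
  rewrite mulN1r -rmorphB; congr (_%:C); rewrite /P.
  by case: (leP (g x) 0) => h; case: (leP (- g x) 0) => h'; lra.
have m1 := localize_cmeasurable mA (L2_cmeasurable L1).
have m2 := localize_cmeasurable mA (L2_cmeasurable L2').
apply: approximableD => //; [exact: cmeasurableZ|exact: approximable_localize_ge0|].
by apply: approximableZ => //; exact: approximable_localize_ge0.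
Qed.

(** Split into real and imaginary parts, then into positive and negative parts,
    which are dominated limits of simple functions. *)
Lemma approximable_localize f : L2 mu D f -> approximable mu D e (localize f A).
Proof.
move=> Lf; have [[m1 m2] _] := (L2P _ _ _).1 Lf.
have L1 : L2 mu D (fun x => (complex.Re (f x))%:C).
  apply: (L2_le Lf); first by split=> //; exact: measurable_cst.
  by move=> x _; rewrite !normc_sq/= expr0n addr0 lerDl sqr_ge0.
have L2' : L2 mu D (fun x => (complex.Im (f x))%:C).
  apply: (L2_le Lf); first by split=> //; exact: measurable_cst.
  by move=> x _; rewrite !normc_sq/= expr0n addr0 lerDr sqr_ge0.
have -> : localize f A = (fun x => localize (fun x => (complex.Re (f x))%:C) A x +
    'i%C * localize (fun x => (complex.Im (f x))%:C) A x).
  apply/funext => x; rewrite /localize mulrA -mulrDl; congr (_ * _).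
  by rewrite {1}[f x]complexE.
have n1 := localize_cmeasurable mA (L2_cmeasurable L1).
have n2 := localize_cmeasurable mA (L2_cmeasurable L2').
apply: approximableD => //; [exact: cmeasurableZ|exact: approximable_localize_real|].
by apply: approximableZ => //; exact: approximable_localize_real.
Qed.

End simple_approximation.
End localization.

(** * Wavelets as combinations of cell functions *)

Lemma euclid_inj (N : nat) (n n' : int) (d d' : nat) : (d < N)%N -> (d' < N)%N ->
  (N%:Z * n + d%:Z == N%:Z * n' + d'%:Z) = (n == n') && (d == d').
Proof.
move=> dN d'N; apply/eqP/andP => [h|[/eqP -> /eqP ->]//].
have nn : n = n' by nia.
by rewrite nn eqxx; split=> //; apply/eqP; move: h; rewrite nn => /addrI [].
Qed.

Lemma euclid_int (N : nat) (k : int) : (0 < N)%N ->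
  exists n (d : nat), (d < N)%N /\ k = N%:Z * n + d%:Z.
Proof.
move=> N0; exists (k %/ N)%Z, (absz (k %% N)%Z); split; lia.
Qed.

Lemma level_gap (m m' : int) : m' < m -> exists j : nat, 1 - m' = 1 - m + 1 + j%:Z.
Proof. by move=> mm; exists (absz (m - m' - 1)%R); lia. Qed.

Lemma level_reach (n : nat) (q : int) : exists j i : nat, q + j%:Z = n%:Z + i%:Z.
Proof. by exists (n + absz q)%N, (absz (q + (absz q)%:Z)%R); lia. Qed.

Section wavelet_basis.
Context {R : realType} (N p : nat) (a : p.-tuple nat) (b : (N - p).-tuple nat).
Hypothesis N2 : (2 <= N)%N.
Hypothesis p2 : (2 <= p)%N.
Hypothesis pN : (p <= N)%N.
Hypothesis a_uniq : uniq a.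
Hypothesis aN : {in a, forall d, (d < N)%N}.
Hypothesis b_compl : perm_eq b [seq d <- iota 0 N | d \notin a].

Local Notation mu := (@fractal_measure R N a).
Local Notation D := (@inflated_fractal R N a : set (measurableTypeR R)).
Local Notation cell := (@cell R N a).
Local Notation closed_cell := (@closed_cell R N a).
Local Notation filt := (@filt R N p a b).
Local Notation sp := (Num.sqrt p%:R : R).

Let N_gt0 : (0 < N)%N. Proof. exact: ltn_trans N2. Qed.
Let NR_neq0 : N%:R != 0 :> R. Proof. by rewrite pnatr_eq0 -lt0n. Qed.
Let p_gt0 : (0 < p)%N. Proof. exact: ltn_trans p2. Qed.
Let pR_gt0 : 0 < p%:R :> R. Proof. by rewrite ltr0n. Qed.
Let sp_neq0 : sp != 0. Proof. by rewrite lt0r_neq0// sqrtr_gt0. Qed.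
Let mD : measurable D. Proof. exact: inflated_fractal_measurable. Qed.

Lemma filt_out i d : (N <= d)%N -> filt i d = 0.
Proof.
move=> Nd; have notin (t : seq nat) j : {in t, forall e, (e < N)%N} -> (j < size t)%N ->
    (d == nth 0%N t j) = false.
  by move=> tN jt; apply/eqP => dj; have := tN _ (mem_nth 0%N jt); rewrite -dj ltnNge Nd.
rewrite /filt; case: ifP => [/andP[i0 iN]|_].
  rewrite notin ?size_tuple ?prednK// => e.
  by rewrite (perm_mem b_compl) mem_filter mem_iota => /andP[].
by rewrite big1 ?mulr0// => j _; rewrite notin ?size_tuple ?mulr0.
Qed.

Lemma poly_T_filter i (f : R -> R[i]) x : (0 < i)%N ->
  poly_T (wavelet_filter N p a b i) f x = \sum_(d < N) filt i d * f (x - d%:R).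
Proof.
move=> i0; rewrite /poly_T; set P := wavelet_filter _ _ _ _ _.
have sP : (size P <= N)%N.
  by apply/leq_sizeP => j Nj; rewrite wavelet_filter_coef// filt_out.
rewrite (big_ord_widen _ (fun k => P`_k * Tpow k f x) sP) big_mkcond.
apply: eq_bigr => d _; rewrite TpowE -wavelet_filter_coef//.
by case: ltnP => // dP; rewrite nth_default ?mul0r.
Qed.

(** U^m T^n U^(-1) T^d = U^(m-1) T^(N n + d). *)
Lemma wavelet_system_closed_cells (m n : int) i x :
  Upow N p m (Tpow n (wavelet N p a b i.+1)) x =
  \sum_(d < N) filt i.+1 d *
    ((sp ^ (1 - m))%:C * cindic R (closed_cell (1 - m) (N%:Z * n + d%:Z)) x).
Proof.
rewrite UpowE// TpowE /wavelet UpowE// opprK !expr1z poly_T_filter//.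
rewrite mulrA mulr_sumr; apply: eq_bigr => d _.
rewrite -rmorphM/= (_ : sp ^ (- m) * sp = sp ^ (1 - m)); last first.
  by rewrite expfzDr// expr1z mulrC.
rewrite mulrCA; congr (_ * (_ * _)).
rewrite /scaling_function /cindic /closed_cell !indicE; congr (_%:R)%:C.
have -> : N%:R * (N%:R ^ (- m) * x - n%:~R) - d%:R =
    N%:R ^ (1 - m) * x - (N%:Z * n + d%:Z)%:~R :> R.
  by rewrite expfzDr// expr1z mulrBr mulrA intrD intrM opprD addrA.
by congr nat_of_bool; apply/idP/idP => /set_mem h; apply/mem_set.
Qed.

(** The normalized indicator of a cell, U^(-q) T^k applied to the indicator of
    the core. *)
Definition cell_fun (q k : int) : measurableTypeR R -> R[i] :=
  fun x => (sp ^ q)%:C * cindic R (cell q k) x.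

(** U^(-q) T^(N n) applied to the sum of the c d T^d, 0 <= d < N, applied to
    the indicator of the core. *)
Definition comb (q n : int) (c : nat -> R[i]) : measurableTypeR R -> R[i] :=
  fun x => \sum_(d < N) c d * cell_fun q (N%:Z * n + d%:Z) x.

Lemma cell_ID q k : cell q k `&` D = cell q k.
Proof. by apply/setIidl; exact: cell_inflated. Qed.

Let mcell q k : measurable (cell q k : set (measurableTypeR R)).
Proof. exact: cell_measurable. Qed.

Lemma cell_indic_L2 q k : L2 mu D (cindic R (cell q k)).
Proof. by apply: cindic_L2 => //; rewrite cell_ID fractal_measure_cell// ltry. Qed.

Lemma cell_fun_L2 q k : L2 mu D (cell_fun q k).
Proof. by apply: L2Z => //; exact: cell_indic_L2. Qed.

Lemma sp_sqr q : sp ^ q * sp ^ q * p%:R ^ (- q) = 1.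
Proof.
have -> : p%:R ^ (- q) = sp ^ (- q) * sp ^ (- q).
  by rewrite -expfzMl -expr2 sqr_sqrtr ?ler0n.
by rewrite mulrACA -expfzDr// addrN expr0z mulr1.
Qed.

Lemma cell_fun_dot q k k' : L2dot mu D (cell_fun q k) (cell_fun q k') = (k == k')%:R.
Proof.
have L k1 := cell_indic_L2 q k1.
rewrite L2dotZl//; last exact: cell_fun_L2.
rewrite L2dotZr// L2dot_cindic// conj_realC.
rewrite mulrA -!rmorphM/=; have [<-|kk] := eqVneq k k'.
  by rewrite setIid cell_ID fractal_measure_cell//= sp_sqr.
rewrite (_ : cell q k `&` cell q k' = set0) ?set0I ?measure0 ?mulr0//.
by apply/seteqP; split=> [x [/cell_floor xk /cell_floor]|//]; rewrite xk => /eqP; rewrite (negPf kk).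
Qed.

Lemma comb_L2 q n c : L2 mu D (comb q n c).
Proof. by apply: L2_sum => // d; apply: L2Z => //; exact: cell_fun_L2. Qed.

Lemma comb_dot q n n' c c' : L2dot mu D (comb q n c) (comb q n' c') =
  (n == n')%:R * \sum_(d < N) c d * (c' d)^*.
Proof.
have L k := cell_fun_L2 q k.
rewrite (@L2dot_sumlZ _ _ _ mu D mD _ _ (fun d : 'I_N => c d)
  (fun d => cell_fun q (N%:Z * n + d%:Z)))//; last exact: comb_L2.
rewrite mulr_sumr; apply: eq_bigr => d _.
rewrite (@L2dot_sumr _ _ _ mu D mD _ _ (fun d : 'I_N => c' d)
  (fun d => cell_fun q (N%:Z * n' + d%:Z)))//.
under eq_bigr => d' _ do rewrite cell_fun_dot euclid_inj//.
rewrite (bigD1 d)//= eqxx andbT big1 ?addr0 => [|d' dd'].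
  by rewrite [RHS]mulrC mulrA.
by rewrite -val_eqE/= eq_sym in dd'; rewrite (negPf dd') andbF mulr0.
Qed.

Lemma cell_indic_refine q n x : \1_(cell q n) x =
  \sum_(j < p) \1_(cell (q + 1) (N%:Z * n + (nth 0%N a j)%:Z)) x :> R.
Proof.
rewrite indicE; have [/set_mem|/negP nx] := boolP (x \in cell q n).
  rewrite cell_split// => -[e ea xe].
  pose j0 := index e a; have jp : (j0 < p)%N by rewrite -(size_tuple a) index_mem.
  rewrite (bigD1 (Ordinal jp))//= nth_index// indicE mem_set// big1 ?addr0// => j jj.
  rewrite indicE memNset// => xj; move: (cell_floor xj); rewrite (cell_floor xe) => /addrI[].
  move=> ej; move/eqP: jj; apply; apply: val_inj => /=.
  by rewrite /j0 ej index_uniq ?size_tuple.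
rewrite big1// => j _; rewrite indicE memNset// => xj; apply: nx; apply/mem_set.
by rewrite cell_split//; exists (nth 0%N a j) => //; rewrite mem_nth ?size_tuple.
Qed.

(** The refinement equation of the scaling function: it holds at every point,
    since the pieces of a cell do not overlap. *)
Lemma cell_fun_refine q n : cell_fun (q - 1) n = comb q n (filt 0).
Proof.
apply/funext => x; rewrite /comb (big_digits a_uniq aN b_compl
  (fun d => filt 0 d * cell_fun q (N%:Z * n + d%:Z) x)).
rewrite [X in _ = _ + X]big1 ?addr0 => [|j _]; last by rewrite filt_b// mul0r.
under eq_bigr => j _ do rewrite filt0_a// /cell_fun mulrA.
rewrite -mulr_sumr /cell_fun (_ : sp ^ (q - 1) = sp^-1 * sp ^ q); last first.
  by rewrite expfzDr// exprN1 mulrC.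
rewrite rmorphM/=; congr (_ * _); rewrite /cindic -rmorph_sum/=; congr (_%:C).
by rewrite cell_indic_refine subrK.
Qed.

(** * Orthonormality *)

(** Descend from e(q, k) to the generation just above that of the wavelet,
    where e is a combination with the coefficients of row 0 of the unitary
    matrix. *)
Lemma cell_fun_cross q (j : nat) k n i : (0 < i < N)%N ->
  L2dot mu D (cell_fun q k) (comb (q + 1 + j%:Z) n (filt i)) = 0.
Proof.
move=> /andP[i0 iN]; have LF r l := cell_fun_L2 r l.
elim: j q k => [|j IH] q k; rewrite -{1}(addrK 1 q) cell_fun_refine.
  by rewrite addr0 comb_dot filt_rows// ltn_eqF// mulr0.
rewrite (@L2dot_sumlZ _ _ _ mu D mD _ _ (fun d : 'I_N => filt 0 d)
  (fun d => cell_fun (q + 1) (N%:Z * k + d%:Z)))//; last exact: comb_L2.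
rewrite big1// => d _; rewrite -addn1 PoszD [j%:Z + _]addrC addrA IH mulr0//.
Qed.

Lemma comb_cross q (j : nat) k c n i : (0 < i < N)%N ->
  L2dot mu D (comb q k c) (comb (q + 1 + j%:Z) n (filt i)) = 0.
Proof.
move=> iN; rewrite (@L2dot_sumlZ _ _ _ mu D mD _ _ (fun d : 'I_N => c d)
  (fun d => cell_fun q (N%:Z * k + d%:Z)))//; first last.
- exact: comb_L2.
- by move=> d; exact: cell_fun_L2.
by rewrite big1// => d _; rewrite cell_fun_cross// mulr0.
Qed.

(** The wavelet system with the fractal replaced by its core. *)
Definition wave (v : int * int * 'I_N.-1) : measurableTypeR R -> R[i] :=
  let: (m, n, i) := v in comb (1 - m) n (filt i.+1).

Lemma wave_L2 v : L2 mu D (wave v).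
Proof. by case: v => -[m n] i; exact: comb_L2. Qed.

Let index_bound (i : 'I_N.-1) : (0 < i.+1 < N)%N.
Proof. by rewrite /= -ltn_predRL ltn_ord. Qed.

Lemma wave_orthonormal : Defs.orthonormal mu D wave.
Proof.
have coarser (m m' n n' : int) (i i' : 'I_N.-1) : m' < m ->
    L2dot mu D (wave (m, n, i)) (wave (m', n', i')) = 0.
  move=> mm; rewrite /wave.
  have [j ->] := level_gap mm; by rewrite comb_cross.
move=> -[[m n] i] [[m' n'] i']; have [mm|mm|<-] := ltgtP m m'.
- rewrite L2dotC//; [|exact: wave_L2..]; rewrite coarser//.
  rewrite (_ : _ == _ = false) ?rmorph0 ?conjc0//.
  by apply/eqP => -[h]; move: mm; rewrite h ltxx.
- rewrite coarser// (_ : _ == _ = false)//.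
  by apply/eqP => -[h]; move: mm; rewrite h ltxx.
have /andP[_ iN] := index_bound i; have /andP[_ i'N] := index_bound i'.
by rewrite comb_dot filt_rows// -natrM mulnb !xpair_eqE eqxx eqSS.
Qed.

(** * Density *)

Local Notation approx := (approximable mu D wave).

(** Inverse transform: the columns of the matrix of filters are orthonormal. *)
Lemma cell_fun_expand q n d x : (d < N)%N -> cell_fun q (N%:Z * n + d%:Z) x =
  (filt 0 d)^* * cell_fun (q - 1) n x +
  \sum_(i < N.-1) (filt i.+1 d)^* * comb q n (filt i.+1) x.
Proof.
move=> dN; rewrite cell_fun_refine.
have -> : (filt 0 d)^* * comb q n (filt 0) x +
    \sum_(i < N.-1) (filt i.+1 d)^* * comb q n (filt i.+1) x =
    \sum_(i < N) (filt i d)^* * comb q n (filt i) x.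
  rewrite -(big_mkord xpredT (fun i => (filt i d)^* * comb q n (filt i) x)).
  by rewrite big_ltn// big_add1/= big_mkord.
under eq_bigr => i _ do rewrite /comb mulr_sumr.
rewrite exchange_big/= (bigD1 (Ordinal dN))//= [X in _ = _ + X]big1 ?addr0 => [|d' dd'].
  under eq_bigr => i _ do rewrite mulrA.
  by rewrite -mulr_suml filt_cols// eqxx mul1r.
under eq_bigr => i _ do rewrite mulrA.
rewrite -mulr_suml filt_cols//.
by rewrite -val_eqE/= eq_sym in dd'; rewrite (negPf dd') mul0r.
Qed.

Lemma normc_filt0 d : (d < N)%N -> normc ((filt 0 d)^*)%R ^+ 2 <= p%:R^-1.
Proof.
move=> dN; have := perm_mem (perm_digits a_uniq aN b_compl) d.
rewrite mem_iota/= add0n dN mem_cat => /orP[] /(nthP 0%N)[j]; rewrite size_tuple => jp <-.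
  rewrite filt0_a// conj_realC normc_sq/= expr0n addr0.
  by rewrite exprVn sqr_sqrtr ?ler0n.
rewrite (_ : filt 0 (nth 0%N b j) = 0); last by rewrite filt_b.
by rewrite rmorph0 normc_sq/= expr0n addr0 invr_ge0 ler0n.
Qed.

Lemma energy_cell_fun q k : energy mu D (cell_fun q k) = 1%E.
Proof.
rewrite /cell_fun energyZ//; last exact: cindic_cmeasurable.
rewrite energy_cindic// cell_ID fractal_measure_cell// -EFinM.
by rewrite normc_sq/= expr0n addr0 expr2 sp_sqr.
Qed.

(** Each expansion multiplies the squared norm of the remainder by
    |m_0[d]|^2 <= 1/p. *)
Lemma cell_fun_remainder M q k : exists l,
  (energy mu D (fun x => (cell_fun q k x - lincomb wave l x)%R) <= ((p%:R ^+ M)^-1)%:E)%E.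
Proof.
elim: M q k => [|M IH] q k.
  exists [::]; rewrite /lincomb; under [fun x => _]funext do rewrite big_nil subr0.
  by rewrite energy_cell_fun expr0 invr1.
have [n [d [dN ->]]] := euclid_int k N_gt0; have [l hl] := IH (q - 1) n.
pose c := ((filt 0 d)^*)%R.
exists ([seq ((1 - q, n, i), ((filt i.+1 d)^*)%R) | i : 'I_N.-1 <- index_enum 'I_N.-1] ++
        [seq (v.1, c * v.2) | v <- l]).
rewrite (_ : (fun x => _) =
    (fun x => c * (cell_fun (q - 1) n x - lincomb wave l x))); last first.
  apply/funext => x; rewrite cell_fun_expand// /lincomb big_cat/= !big_map/=.
  rewrite opprB addrCA subrr addr0.
  rewrite mulrBr opprD addrA; congr (_ - _); last first.
    by rewrite mulr_sumr; apply: eq_bigr => v _; rewrite mulrA.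
  by rewrite addrK.
have L : L2 mu D (fun x => cell_fun (q - 1) n x - lincomb wave l x).
  by apply: L2B => //; [exact: cell_fun_L2|exact: L2_lincomb wave_L2 _].
rewrite energyZ//; last exact: L2_cmeasurable L.
apply: (@le_trans _ _ ((p%:R^-1)%:E * (p%:R ^+ M)^-1%:E)%E); last first.
  by rewrite -EFinM lee_fin exprS invfM.
by apply: lee_pmul => //; rewrite ?lee_fin ?sqr_ge0 ?energy_ge0 ?normc_filt0.
Qed.

Lemma cell_fun_approximable q k : approx (cell_fun q k).
Proof.
move=> eps eps0.
have [n pn] := exp_inv_lt p2 eps0.
have [l hl] := cell_fun_remainder n q k.
by exists l; apply: le_trans hl _; rewrite lee_fin ltW.
Qed.

Lemma cell_approximable q k : approx (cindic R (cell q k)).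
Proof.
have -> : cindic R (cell q k) = (fun x => (sp ^ (- q))%:C * cell_fun q k x).
  apply/funext => x; rewrite /cell_fun mulrA -rmorphM/= -expfzDr// addNr expr0z.
  by rewrite mul1r.
apply: approximableZ => //; first exact: wave_L2.
  exact: L2_cmeasurable (cell_fun_L2 _ _).
exact: cell_fun_approximable.
Qed.


(** The half-open N-adic intervals, with the empty set added for stability
    under intersection. *)
Let adic_intervals : set (set R) :=
  [set A | A = set0 \/ exists n m, A = [set x | level N n x = m]].

Lemma level_sets_setI : setI_closed adic_intervals.
Proof.
suff H n j m m' : adic_intervals
    ([set x : R | level N n x = m] `&` [set x | level N (j + n) x = m']).
  move=> A B [->|[n [m ->]]]; first by left; rewrite set0I.
  move=> [->|[n' [m' ->]]]; first by left; rewrite setI0.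
  have [nn|/ltnW nn] := leqP n n'; first by rewrite -(subnK nn).
  by rewrite -(subnK nn) setIC.
have [[x [xm xm']]|no] :=
  pselect (exists x : R, level N n x = m /\ level N (j + n) x = m').
  right; exists (j + n)%N, m'; apply/seteqP; split=> [y []//|y /= ym'].
  split=> //; rewrite /= -xm; apply: (level_coarsen N2 (j := j)).
  by rewrite -PoszD addnC -!exprnP -!/(level N (j + n) _) ym' xm'.
by left; apply/seteqP; split=> // x [xm xm']; apply: no; exists x.
Qed.

Lemma le_levels (r x : R) : (forall n, level N n r <= level N n x) -> r <= x.
Proof.
move=> h; rewrite leNgt; apply/negP => xr.
have rx0 : 0 < r - x by rewrite subr_gt0.
have N0 : 0 < N%:R :> R by rewrite ltr0n.
have [n] := exp_inv_lt N2 rx0.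
rewrite -(ltr_pM2l (exprn_gt0 n N0)) divff ?expf_neq0// mulrBr => rx.
have := h n; rewrite /level floor_ge_int => hn.
have := floorD1_gt (N%:R ^+ n * r); rewrite intrD mulr1z; lra.
Qed.

(** By [le_levels], the ray from r to infinity is the intersection over n of the
    unions of the level sets of index at least [level N n r]. *)
Lemma borel_level_sets : @measurable _ (measurableTypeR R) = <<s adic_intervals >>.
Proof.
apply/seteqP; split; last first.
  apply: smallest_sub; first exact: sigma_algebra_measurable.
  by move=> A [->//|[n [m ->]]]; exact: level_measurable.
have mlevel n m : adic_intervals.-sigma.-measurable [set x : R | level N n x = m].
  by apply: sub_sigma_algebra; right; exists n, m.
move=> A mA; have {mA} : (@RGenCInfty.G R).-sigma.-measurable A.
  by rewrite -RGenCInfty.measurableE.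
move: A; apply: smallest_sub; first exact: smallest_sigma_algebra.
move=> _ [r ->].
rewrite (_ : `[r, +oo[%classic = \bigcap_n \bigcup_(m : int)
    if level N n r <= m then [set x : R | level N n x = m] else set0).
  apply: (@bigcapT_measurable _ (g_sigma_algebraType adic_intervals)) => n.
  apply: (@countable_bigcupT_measurable _ (g_sigma_algebraType adic_intervals)) => // m.
  by case: ifP.
apply/seteqP; split=> [x /=|x /= h].
  rewrite in_itv/= andbT => rx n _; exists (level N n x) => //.
  rewrite ifT//; apply: le_floor; rewrite ler_pM2l// exprn_gt0// ltr0n //.
rewrite in_itv/= andbT; apply: le_levels => n.
by have [m _] := h n I; case: ifP => // rm ->.
Qed.

Let approximable_empty : approx (cindic R (set0 : set (measurableTypeR R))).
Proof.
rewrite (_ : cindic R set0 = fun=> 0); first exact: approximable0.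
by apply/funext => x; rewrite /cindic indicE in_set0.
Qed.

(** Split the cell until its generation reaches n; each piece is then inside the
    level set or disjoint from it. *)
Lemma level_cell_approximable n m q k :
  approx (cindic R ([set x | level N n x = m] `&` cell q k)).
Proof.
have [j [i qj]] := level_reach n q.
elim: j q k qj => [|j IH] q k qj.
  have [[x [xm xk]]|no] := pselect (exists x, level N n x = m /\ cell q k x).
    rewrite (_ : _ `&` _ = cell q k); first exact: cell_approximable.
    apply: setIidr => y yk; rewrite /= -xm.
    by move: yk xk; rewrite -[q]addr0 qj; exact: cell_level.
  rewrite (_ : _ `&` _ = set0); first exact: approximable_empty.
  by apply/seteqP; split=> // x [xm xk]; apply: no; exists x.
rewrite (_ : cindic R _ = (fun x => \sum_(d < p)
    cindic R ([set x | level N n x = m] `&` cell (q + 1) (N%:Z * k + (nth 0%N a d)%:Z)) x)).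
  have mI l : measurable ([set x | level N n x = m] `&` cell (q + 1) l :
      set (measurableTypeR R)).
    by apply: measurableI => //; exact: level_measurable.
  apply: approximable_sum => // [|d|d]; first exact: wave_L2.
    exact: cindic_cmeasurable.
  by apply: IH; rewrite -qj -addn1 PoszD -addrA [1 + _]addrC.
apply/funext => x; rewrite /cindic -rmorph_sum/=; congr (_%:C).
rewrite indicI/= cell_indic_refine mulr_sumr; apply: eq_bigr => d _.
by rewrite indicI.
Qed.

(** The Borel sets A for which the indicators of all A `&` cell q k are
    approximable form a Dynkin class containing the N-adic intervals. *)
Lemma measurable_cell_approximable (A : set (measurableTypeR R)) q k :
  measurable A -> approx (cindic R (A `&` cell q k)).
Proof.
move=> mA; pose P (A : set (measurableTypeR R)) :=
  forall q k, approx (cindic R (A `&` cell q k)).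
suff : P A by exact.
have mI (B : set (measurableTypeR R)) r l : measurable B ->
  measurable (B `&` cell r l : set (measurableTypeR R)) by move=> ?; exact: measurableI.
apply: (dynkin_induction borel_level_sets level_sets_setI) => //.
- by move=> r l; rewrite setTI; exact: cell_approximable.
- move=> _ [->|[n [m ->]]] r l; last exact: level_cell_approximable.
  by rewrite set0I; exact: approximable_empty.
- move=> S mS PS r l.
  rewrite (_ : cindic R (~` S `&` cell r l) = (fun x : measurableTypeR R =>
      cindic R (cell r l) x + (-1) * cindic R (S `&` cell r l) x)).
    apply: approximableD => //.
    + exact: wave_L2.
    + exact: cindic_cmeasurable.
    + by apply: cmeasurableZ; apply: cindic_cmeasurable; exact: mI.
    + exact: cell_approximable.
    + apply: approximableZ => //; first exact: wave_L2.
      by apply: cindic_cmeasurable; exact: mI.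
  apply/funext => x; rewrite mulN1r /cindic -rmorphB; congr (_%:C).
  move: (cell r l) => c; rewrite !indicI/= !indicE in_setC.
  by case: (x \in S); case: (x \in c); rewrite /= ?mulr1 ?mulr0 ?mul0r ?subr0 ?subrr.
- move=> F mF tF PF r l.
  have LF : L2 mu D (cindic R ((\bigcup_k F k) `&` cell r l)).
    apply: (L2_le mD (cell_indic_L2 r l)).
      by apply: cindic_cmeasurable; apply: mI; exact: bigcupT_measurable.
    move=> x _; rewrite /cindic !indicE.
    have [/set_mem[_ xc]|_] := boolP (x \in (\bigcup_k F k) `&` cell r l).
      by rewrite (mem_set xc).
    by rewrite rmorph0 normc_sq/= expr0n addr0 sqr_ge0.
  apply: (@approximable_localize_bigcup _ _ _ mu D mD _ wave wave_L2 _ F LF mF tF).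
    apply: aeW => x _; have [xF|nF] := pselect ((\bigcup_j F j) x); [by right|left].
    by rewrite /cindic indicE memNset ?rmorph0// => -[].
  move=> j; rewrite localize_cindic.
  rewrite (_ : _ `&` F j = F j `&` cell r l); first exact: PF.
  by apply/seteqP; split=> [y [[_ yc] yF] //|y [yF yc]]; split=> //; split=> //; exists j.
- by rewrite -borel_level_sets.
Qed.

(** The inflated fractal is covered, up to a countable set, by countably many
    cells, which are made disjoint by an enumeration. *)
Lemma all_approximable f : L2 mu D f -> approx f.
Proof.
move=> Lf; pose B n : set (measurableTypeR R) :=
  if @choice.unpickle (int * int)%type n is Some v then cell v.1 v.2 else set0.
have mB n : measurable (B n) by rewrite /B; case: choice.unpickle.
apply: (@approximable_localize_bigcup _ _ _ mu D mD _ wave wave_L2 _ (seqDU B)) => //.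
- exact: seqDU_measurable.
- rewrite -seqDU_bigcup_eq; exists (D `\` \bigcup_(v : int * int) cell v.1 v.2); split.
  + apply: measurableD => //; apply: countable_bigcupT_measurable => // v.
  + exact: fractal_measure_countable (inflated_fractal_countable N2 aN).
  + move=> x /= h; split; first by apply: contrapT => nD; apply: h.
    move=> [v _ xv]; apply: h => _; right; exists (choice.pickle v) => //.
    by rewrite /B choice.pickleK.
- move=> n; have mS := seqDU_measurable mB n.
  case Bn : (@choice.unpickle (int * int)%type n) => [v|].
    have BC : seqDU B n `<=` cell v.1 v.2.
      by move=> y yS; have := subset_seqDU yS; rewrite /B Bn.
    rewrite -(setIidl BC) -localize_localize.
    apply: (approximable_localize mD wave_L2 (mcell v.1 v.2)); last exact: localize_L2.
    by move=> S mS'; exact: measurable_cell_approximable.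
  rewrite (_ : localize f _ = fun=> 0); first exact: approximable0.
  apply/funext => x; rewrite /localize /cindic indicE memNset ?rmorph0 ?mulr0//.
  by move=> xS; have := subset_seqDU xS; rewrite /B Bn.
Qed.

Lemma wave_basis : orthonormal_basis mu D wave.
Proof.
split; [exact: wave_L2|exact: wave_orthonormal|].
by apply: dense_span_approximable; exact: all_approximable.
Qed.

Definition wavelet_system (v : int * int * 'I_N.-1) : measurableTypeR R -> R[i] :=
  let: (m, n, i) := v in Upow N p m (Tpow n (wavelet N p a b i.+1)).

Lemma wavelet_system_L2 v : L2 mu D (wavelet_system v).
Proof.
case: v => -[m n] i; rewrite (_ : wavelet_system _ = (fun x => \sum_(d < N) filt i.+1 d *
    ((sp ^ (1 - m))%:C * cindic R (closed_cell (1 - m) (N%:Z * n + d%:Z)) x))); last first.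
  by apply/funext => x; exact: wavelet_system_closed_cells.
apply: L2_sum => // d; apply: L2Z => //; apply: L2Z => //.
set r := 1 - m; set l := _ + _.
have mcc : measurable (closed_cell r l : set (measurableTypeR R)).
  exact: closed_cell_measurable.
apply: cindic_L2 => //; apply: (@le_lt_trans _ _ (mu (closed_cell r l))).
  by apply: le_measure; rewrite ?inE//; exact: measurableI.
have cs : cell r l `<=` closed_cell r l by move=> x; exact: core_fractal.
rewrite -(setDUK cs).
apply: (@le_lt_trans _ _ (mu (cell r l) + mu (closed_cell r l `\` cell r l))%E).
  by apply: measureU2 => //; exact: measurableD.
rewrite fractal_measure_cell//.
rewrite (fractal_measure_countable a p2 N2 (closed_cell_countable N2 aN r l)).
by rewrite adde0 ltry.
Qed.

(** The two systems differ only at points of a closed cell outside the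
    corresponding cell, which form a countable set. *)
Lemma wave_ae v : {ae mu, forall x, D x -> wave v x = wavelet_system v x}.
Proof.
case: v => -[m n] i; exists (\bigcup_(l : int) (closed_cell (1 - m) l `\` cell (1 - m) l)).
split.
- apply: countable_bigcupT_measurable => // l; apply: measurableD => //.
  exact: closed_cell_measurable.
- apply: fractal_measure_countable => //; apply: bigcup_countable => // l _.
  exact: closed_cell_countable.
- move=> x /= h; apply: contrapT => nx; apply: h => _.
  rewrite wavelet_system_closed_cells /comb; apply: eq_bigr => d _; congr (_ * (_ * _)).
  rewrite /cindic !indicE; congr (_%:R)%:C; congr nat_of_bool.
  apply/idP/idP => /set_mem xc; apply/mem_set; first exact: core_fractal.
  by apply: contrapT => nc; apply: nx; exists (N%:Z * n + d%:Z).
Qed.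

Lemma wavelet_system_basis : orthonormal_basis mu D wavelet_system.
Proof.
apply: (orthonormal_basis_ae mD wavelet_system_L2 wave_ae); exact: wave_basis.
Qed.

End wavelet_basis.

Theorem mainTheorem1 (R : realType) (N p : nat) (hN : (2 <= N)%N)
    (hp : (2 <= p <= N)%N) (a : p.-tuple nat) (a_uniq : uniq a)
    (a_digits : {in a, forall d, (d < N)%N})
    (b : (N - p).-tuple nat)
    (b_compl : perm_eq b [seq d <- iota 0 N | d \notin a]) :
  orthonormal_basis (fractal_measure N a) (inflated_fractal N a)
    (fun mni : int * int * 'I_N.-1 =>
       let: (m, n, i) := mni in
       Upow N p m (Tpow n (wavelet N p a b i.+1))
         : measurableTypeR R -> R[i]).
Proof.
by have /andP[p2 pN] := hp; exact: wavelet_system_basis.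
Qed.
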